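(* Let $(Q,\mathcal U)$ and $(Q',\mathcal U')$ be orbifolds, $\mathcal V$ a representative of $\mathcal U$, and $\mathcal V'$ a representative of $\mathcal U'$. Then the set $\operatorname{Orb}(\mathcal V,\mathcal V')$ of all orbifold maps with $(\mathcal V,\mathcal V')$ and the set $\operatorname{Hom}(\Gamma(\mathcal V),\Gamma(\mathcal V'))$ of all homomorphisms of Lie groupoids from $\Gamma(\mathcal V)$ to $\Gamma(\mathcal V')$ are in bijection. More precisely, the assignment $F_1$ which sends $(f,\{\tilde f_i\}_{i\in I},[P,\nu])$ to the homomorphism $(\varphi_0,\varphi_1)$ given by $$\varphi_0=\coprod_{i\in I}\tilde f_i,\qquad \varphi_1(\operatorname{germ}_x\lambda)=\operatorname{germ}_{\varphi_0(x)}\nu(\lambda)\quad(\lambda\in P,\ x\in\operatorname{dom}\lambda)$$ is a bijection $F_1\colon\operatorname{Orb}(\mathcal V,\mathcal V')\to\operatorname{Hom}(\Gamma(\mathcal V),\Gamma(\mathcal V'))$, and the assignment $F_2$ which sends a homomorphism $\varphi=(\varphi_0,\varphi_1)$ to the class $(f,\{\tilde f_i\}_{i\in I},[P,\nu])$ with $f=\alpha_{\mathcal V'}\circ|\varphi|\circ\alpha_{\mathcal V}^{-1}$, $\tilde f_i=\varphi_0|_{V_i}$, and $(P,\nu)$ such that $\varphi_1(\operatorname{germ}_x\lambda)=\operatorname{germ}_{\varphi_0(x)}\nu(\lambda)$ for all $\lambda\in P$, $x\in\operatorname{dom}\lambda$, is a bijection $F_2\colon\operatorname{Hom}(\Gamma(\mathcal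 V),\Gamma(\mathcal V'))\to\operatorname{Orb}(\mathcal V,\mathcal V')$ which is inverse to $F_1$.
   Context: Orbifolds. All manifolds are real, smooth ($C^\infty$), Hausdorff and paracompact. Let $Q$ be a topological space, $n\in\mathbb N_0$. A (reduced) orbifold chart of dimension $n$ on $Q$ is a triple $(V,G,\varphi)$ where $V$ is a connected $n$-manifold without boundary, $G$ is a finite subgroup of $\mathrm{Diff}(V)$, and $\varphi\colon V\to Q$ is a map with open image inducing a homeomorphism $G\backslash V\to\varphi(V)$. Charts $(V,G,\varphi),(W,H,\psi)$ are compatible if for each $(x,y)\in V\times W$ with $\varphi(x)=\psi(y)$ there are open connected neighborhoods $\widetilde V\subseteq V$ of $x$, $\widetilde W\subseteq W$ of $y$ and a diffeomorphism $h\colon\widetilde V\to\widetilde W$ (a change of charts) with $\psi\circ h=\varphi|_{\widetilde V}$. An orbifold atlas is a set of pairwise compatible orbifold charts of the same dimension on $Q$ whose images cover $Q$; two atlases are equivalent if their union is an atlas; an orbifold structure $\mathcal U$ on $Q$ is an equivalence class of atlases, its elements are called representatives of $\mathcal U$, and ''a chart in $\mathcal U$'' means a chart belonging to some representative. An orbifold is a pair $(Q,\mathcal U)$ with $Q$ a Hausdorff space that is paracompact (resp. second-countable) and $\mathcal U$ an orbifold structure on $Q$; there are thus two parallel versions, the result holds in both, and in the second-countable version all representatives are taken countable. A family is indexed by $I$ if $i\mapsto A_i$ is a bijection onto its set of members. An embedding $(V,G,\varphi)\to(W,H,\psi)$ of orbifold charts of equal dimension is an (automatically open) embedding of manifolds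 $\mu\colon V\to W$ with $\psi\circ\mu=\varphi$. Atlas groupoids. A transition on a manifold $M$ is a diffeomorphism between open subsets of $M$. For a representative $\mathcal V=\{(V_i,G_i,\pi_i)\mid i\in I\}$ of $\mathcal U$ (indexed by $I$) put $V=\coprod_i V_i$, $\pi=\coprod_i\pi_i\colon V\to Q$, and let $\Psi(\mathcal V)$ be the set of transitions $f$ on $V$ with $\pi\circ f=\pi|_{\operatorname{dom}f}$. The atlas groupoid $\Gamma(\mathcal V)$ has objects $\Gamma(\mathcal V)_0=V$ and arrows $\operatorname{germ}_xf$ ($f\in\Psi(\mathcal V)$, $x\in\operatorname{dom}f$), with source $x$, target $f(x)$ and composition of germs; the smooth structure is such that for each $f$ the set $\{\operatorname{germ}_xf\mid x\in\operatorname{dom} f\}$ is open and $\operatorname{germ}_xf\mapsto x$ is a diffeomorphism of it onto $\operatorname{dom}f$. It is an étale Lie groupoid. $|\Gamma(\mathcal V)|$ is its orbit space and $\alpha_{\mathcal V}\colon|\Gamma(\mathcal V)|\to Q$, $[x]\mapsto\pi(x)$, which is a homeomorphism. A homomorphism of Lie groupoids is a functor $\varphi=(\varphi_0,\varphi_1)$ with $\varphi_0,\varphi_1$ smooth; $|\varphi|$ is the induced map on orbit spaces. Charted orbifold maps. A local lift of a continuous $f\colon Q\to Q'$ w.r.t. charts $(V,G,\pi)$ in $\mathcal U$, $(V',G',\pi')$ in $\mathcal U'$ is a smooth $\tilde f\colon V\to V'$ with $\pi'\circ\tilde f=f\circ\pi$. A quasi-pseudogroup on $M$ is a set $P$ of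 transitions on $M$ such that (i) for $f\in P$, $x\in\operatorname{dom}f$ there are $g\in P$ and open sets $U$, $V$ with $x\in U\subseteq\operatorname{dom}f$, $f(x)\in V\subseteq\operatorname{dom}g$, $(f|_U)^{-1}=g|_V$; (ii) for $f,g\in P$ and $x\in f^{-1}(\operatorname{cod}f\cap\operatorname{dom}g)$ there are $h\in P$ and an open $U$ with $x\in U\subseteq f^{-1}(\operatorname{cod}f\cap\operatorname{dom}g)\cap\operatorname{dom}h$ and $g\circ f|_U=h|_U$. $P$ generates $\Psi(\mathcal V)$ if $P\subseteq\Psi(\mathcal V)$ and every $f\in\Psi(\mathcal V)$ agrees near each $x\in\operatorname{dom}f$ with some $g\in P$, $x\in\operatorname{dom}g$. Let $\mathcal V=\{(V_i,G_i,\pi_i)\mid i\in I\}$ (indexed by $I$) and $\mathcal V'$ be representatives of $\mathcal U$, $\mathcal U'$. A representative of an orbifold map with domain atlas $\mathcal V$ and range family contained in $\mathcal V'$ is a tuple $(f,\{\tilde f_i\}_{i\in I},P,\nu)$ where $f\colon Q\to Q'$ is continuous; $\tilde f_i$ is a local lift of $f$ w.r.t. $(V_i,G_i,\pi_i)$ and some $(V_i',G_i',\pi_i')\in\mathcal V'$; $P$ is a quasi-pseudogroup of changes of charts of $\mathcal V$ generating $\Psi(\mathcal V)$; and, with $\psi=\coprod_i\tilde f_i$, $\nu\colon P\to\Psi(\mathcal V')$ assigns to each $\lambda\in P$ an element of $\Psi(\mathcal V')$ that is an embedding between orbifold charts in $\mathcal U'$ (its domain underlies a chart in $\mathcal U'$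 obtained by restriction of a chart of $\mathcal V'$, and it embeds this chart in a chart of $\mathcal V'$), such that: (a) $\psi\circ\lambda=\nu(\lambda)\circ\psi|_{\operatorname{dom}\lambda}$; (b) $\operatorname{germ}_x\lambda=\operatorname{germ}_x\mu$ implies $\operatorname{germ}_{\psi(x)}\nu(\lambda)=\operatorname{germ}_{\psi(x)}\nu(\mu)$; (c) if $h\in P$ agrees with $\mu\circ\lambda$ near $x$ then $\operatorname{germ}_{\psi(\lambda(x))}\nu(\mu)\cdot\operatorname{germ}_{\psi(x)}\nu(\lambda)=\operatorname{germ}_{\psi(x)}\nu(h)$; (d) if $\lambda$ is the identity near $x$ then $\operatorname{germ}_{\psi(x)}\nu(\lambda)=\operatorname{germ}_{\psi(x)}\mathrm{id}$. Two such representatives $(f,\{\tilde f_i\},P_1,\nu_1)$, $(g,\{\tilde g_i\},P_2,\nu_2)$ are equivalent if $f=g$, $\tilde f_i=\tilde g_i$ for all $i$ and $\operatorname{germ}_{\psi(x)}\nu_1(\lambda_1)=\operatorname{germ}_{\psi(x)}\nu_2(\lambda_2)$ whenever $\lambda_k\in P_k$ and $\operatorname{germ}_x\lambda_1=\operatorname{germ}_x\lambda_2$. The equivalence classes, written $(f,\{\tilde f_i\},[P,\nu])$, are the orbifold maps with $(\mathcal V,\mathcal V')$; their set is $\operatorname{Orb}(\mathcal V,\mathcal V')$. *)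

(* Defs.v *)
From HB Require Import structures.
From mathcomp Require Import all_boot all_order all_algebra.
From mathcomp Require Import all_classical all_reals all_analysis.

Set Implicit Arguments.
Unset Strict Implicit.
Unset Printing Implicit Defensive.

Import Order.TTheory GRing.Theory Num.Theory.
Import numFieldNormedType.Exports.

Local Open Scope classical_set_scope.
Local Open Scope ring_scope.

Section Smooth.
Context {R : realType}.

(* f is C^k on O, in terms of iterated Frechet derivatives. *)
Fixpoint Ck (V W : normedModType R) (k : nat) (O : set V) (f : V -> W) : Prop :=
  if k is k'.+1 then
    (forall x, O x -> differentiable f x) /\
    (forall v, Ck k' O (fun x => 'd f x v))
  else forall x, O x -> {for x, continuous f}.

(* f is C^oo on a neighborhood of x. *)
Definition smooth_near n m (x : 'rV[R]_n) (f : 'rV[R]_n -> 'rV[R]_m) :=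
  exists O : set 'rV[R]_n, [/\ open O, O x & forall k, Ck k O f].

Lemma diff_near_eq (V W : normedModType R) (f g : V -> W) x :
  (\forall y \near x, f y = g y) -> differentiable f x ->
  differentiable g x /\ 'd g x = 'd f x :> (V -> W).
Proof.
move=> fg df; have [dc dE] := (diff_locallyP x f).1 df.
have gE : g \o shift x = cst (g x) + 'd f x +o_ 0 id.
  apply/eqaddoP => e e0; move/eqaddoP : dE => /(_ e e0) H.
  have fgx : f x = g x by exact: (nbhs_singleton fg).
  have fg0 : \forall h \near (0 : V), f (h + x) = g (h + x).
    have := fg; rewrite (near_shift 0) subr0; exact.
  apply: filterS2 H fg0 => h Hh fgh.
  by move: Hh; rewrite !fctE /= fgh fgx.
have dg : 'd g x = 'd f x :> (V -> W) by exact: diff_unique.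
split; last exact: dg.
by apply/diff_locallyP; rewrite dg; split; [exact: dc|exact: gE].
Qed.

Lemma Ck_ext (V W : normedModType R) k (O : set V) (f g : V -> W) :
  open O -> (forall x, O x -> f x = g x) -> Ck k O f -> Ck k O g.
Proof.
move=> oO; elim: k f g => [|k IH] f g fg /=.
  move=> fc x Ox; have gf : \forall y \near x, f y = g y.
    by near=> y; apply: fg; near: y; exact: open_nbhs_nbhs.
  have fcx : f @ x --> f x := fc x Ox.
  have : g @ x --> f x by exact: cvg_trans (near_eq_cvg gf) fcx.
  by rewrite (fg x Ox).
have nr x : O x -> \forall y \near x, f y = g y.
  by move=> Ox; near=> y; apply: fg; near: y; exact: open_nbhs_nbhs.
move=> [df Hf]; split=> [x Ox|v]; first exact: (diff_near_eq (nr x Ox) (df x Ox)).1.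
apply: IH (Hf v) => x Ox.
exact: (esym (congr1 (fun h : V -> W => h v) (diff_near_eq (nr x Ox) (df x Ox)).2)).
Unshelve. all: by end_near. Qed.

Lemma Ck_sub (V W : normedModType R) k (O O' : set V) (f : V -> W) :
  O' `<=` O -> Ck k O f -> Ck k O' f.
Proof.
move=> sO; elim: k f => [|k IH] f /=; first by move=> fc x /sO; exact: fc.
by move=> [df Hf]; split=> [x /sO|v]; [exact: df|apply: IH].
Qed.

Lemma Ck_cst (V W : normedModType R) k (O : set V) (c : W) :
  Ck k O (fun=> c).
Proof.
elim: k c => [|k IH] c /=; first by move=> x _; exact: cst_continuous.
split=> [x _|v]; first exact: differentiable_cst.
rewrite (_ : (fun x => _) = fun=> 0) //.
by apply/funext => x; rewrite (diff_cst c x).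
Qed.

Lemma CkD (V W : normedModType R) k (O : set V) (f g : V -> W) : open O ->
  Ck k O f -> Ck k O g -> Ck k O (fun x => f x + g x).
Proof.
move=> oO; elim: k f g => [|k IH] f g /=.
  by move=> fc gc x Ox; apply: continuousD; [exact: fc|exact: gc].
move=> [df Hf] [dg Hg]; split=> [x Ox|v].
  by apply: differentiableD; [exact: df|exact: dg].
apply: (Ck_ext oO _ (IH _ _ (Hf v) (Hg v))) => x Ox.
exact: (esym (congr1 (fun h : V -> W => h v) (diffD (df x Ox) (dg x Ox)))).
Qed.

Lemma Ck_pred (V W : normedModType R) k (O : set V) (f : V -> W) :
  Ck k.+1 O f -> Ck k O f.
Proof.
elim: k W f => [|k IHk] W f [dh Hh].
  by move=> x Ox; exact/differentiable_continuous/dh.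
by split=> // v; apply: IHk; exact: Hh.
Qed.

Lemma CkM (V : normedModType R) k (O : set V) (f g : V -> R) : open O ->
  Ck k O f -> Ck k O g -> Ck k O (fun x => f x * g x).
Proof.
move=> oO.
elim: k f g => [|k IH] f g.
  by move=> fc gc x Ox; apply: continuousM; [exact: fc|exact: gc].
move=> cf cg; have [df Hf] := cf; have [dg Hg] := cg.
split=> [x Ox|v].
  by apply: differentiableM; [exact: df|exact: dg].
have := CkD oO (IH _ _ (Ck_pred cf) (Hg v)) (IH _ _ (Ck_pred cg) (Hf v)).
apply: (Ck_ext oO) => x Ox.
exact: (esym (congr1 (fun h : V -> R => h v) (diffM (df x Ox) (dg x Ox)))).
Qed.

Lemma Ck_lin (V W X : normedModType R) k (O : set V) (f : V -> W)
    (L : {linear W -> X}) : open O -> continuous L ->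
  Ck k O f -> Ck k O (fun x => L (f x)).
Proof.
move=> oO cL; elim: k f => [|k IH] f /=.
  by move=> fc x Ox; apply: continuous_comp; [exact: fc|exact: cL].
move=> [df Hf]; split=> [x Ox|v].
  by apply: differentiable_comp; [exact: df|exact: linear_differentiable].
apply: (Ck_ext oO _ (IH _ (Hf v))) => x Ox.
have dL := diff_comp (df x Ox) (linear_differentiable (f x) cL).
rewrite (congr1 (fun h : V -> X => h v) dL) /=.
exact: (esym (congr1 (fun h : W -> X => h _) (diff_lin (f x) cL))).
Qed.

Lemma Ck_sum (V W : normedModType R) k (O : set V) n (f : 'I_n -> V -> W) :
  open O -> (forall i, Ck k O (f i)) -> Ck k O (fun x => \sum_i f i x).
Proof.
move=> oO H; elim: n f H => [|n IH] f H.
  by apply: (Ck_ext oO _ (Ck_cst k O 0)) => x _; rewrite big_ord0.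
apply: (Ck_ext oO _ (CkD oO (H ord0) (IH _ (fun i => H (lift ord0 i))))) => x _.
by rewrite big_ord_recl.
Qed.

Definition coordL n (j : 'I_n) (v : 'rV[R]_n) : R := v 0 j.
Lemma coordL_linear n (j : 'I_n) : linear (@coordL n j).
Proof. by move=> a u v; rewrite /coordL !mxE. Qed.
HB.instance Definition _ n (j : 'I_n) :=
  GRing.isLinear.Build R 'rV[R]_n R _ (@coordL n j) (@coordL_linear n j).

Lemma Ck_coord (V : normedModType R) n k (O : set V) (f : V -> 'rV[R]_n) j :
  open O -> Ck k O f -> Ck k O (fun x => f x 0 j).
Proof.
move=> oO; apply: (@Ck_lin _ _ _ _ _ _ (@coordL n j)) => //.
exact: coord_continuous.
Qed.

Definition scaleL (W : normedModType R) (w : W) (r : R) : W := r *: w.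
Lemma scaleL_linear (W : normedModType R) (w : W) : linear (@scaleL W w).
Proof. by move=> a u v; rewrite /scaleL scalerDl scalerA. Qed.
HB.instance Definition _ (W : normedModType R) (w : W) :=
  GRing.isLinear.Build R R W _ (@scaleL W w) (@scaleL_linear W w).

Lemma Ck_row (V : normedModType R) n k (O : set V) (f : V -> 'rV[R]_n) :
  open O -> (forall j, Ck k O (fun x => f x 0 j)) -> Ck k O f.
Proof.
move=> oO H.
have H' j : Ck k O (fun x => scaleL (delta_mx 0 j : 'rV[R]_n) (f x 0 j)).
  by apply: Ck_lin => //; exact: scalel_continuous.
by apply: (Ck_ext oO _ (Ck_sum oO H')) => x _; rewrite [RHS]row_sum_delta.
Qed.

Lemma Ck_comp (V : normedModType R) n k (O : set V) (O' : set 'rV[R]_n)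
    (f : V -> 'rV[R]_n) (g : 'rV[R]_n -> R) : open O -> open O' ->
  (forall x, O x -> O' (f x)) ->
  Ck k O f -> Ck k O' g -> Ck k O (fun x => g (f x)).
Proof.
move=> oO oO' OO'; elim: k g => [|k IH] g cf cg.
  by move=> x Ox; apply: continuous_comp; [exact: cf|apply: cg; exact: OO'].
have [df Hf] := cf; have [dg Hg] := cg; split=> [x Ox|v].
  by apply: differentiable_comp; [exact: df|apply: dg; exact: OO'].
have H j : Ck k O (fun x => 'd f x v 0 j * 'd g (f x) (delta_mx 0 j)).
  apply: CkM => //; first by apply: Ck_coord => //; exact: Hf.
  by apply: (IH (fun y => 'd g y (delta_mx 0 j))); [exact: Ck_pred cf|exact: Hg].
apply: (Ck_ext oO _ (Ck_sum oO H)) => x Ox.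
have dgf := diff_comp (df x Ox) (dg (f x) (OO' x Ox)).
rewrite (congr1 (fun h : V -> R => h v) dgf) /=.
rewrite [X in _ = 'd g (f x) X](row_sum_delta ('d f x v)) linear_sum.
by apply: eq_bigr => j _; rewrite linearZ.
Qed.

Lemma smooth_near_comp n m p (x : 'rV[R]_n) (f : 'rV[R]_n -> 'rV[R]_m)
    (g : 'rV[R]_m -> 'rV[R]_p) :
  smooth_near x f -> smooth_near (f x) g -> smooth_near x (fun y => g (f y)).
Proof.
move=> [U [oU Ux sf]] [U' [oU' U'x sg]].
have oW : open (U `&` f @^-1` U').
  rewrite openE => y [Uy U'y]; apply: filterI; first exact: open_nbhs_nbhs.
  by apply: (sf 0 y Uy); exact: open_nbhs_nbhs.
exists (U `&` f @^-1` U'); split=> // k.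
apply: Ck_row => // j.
apply: (@Ck_comp _ _ _ _ U' f (fun y => g y 0 j)) => //.
- by move=> ? [].
- by apply: Ck_sub (sf k) => ? [].
- exact: Ck_coord.
Qed.

Lemma smooth_near_id n (x : 'rV[R]_n) : smooth_near x id.
Proof.
exists setT; split=> [|//|k]; first exact: openT.
case: k => [|k] /=; first by move=> ? _ ?.
split=> [y _|v] //.
rewrite (_ : (fun y => _) = fun=> v); first exact: Ck_cst.
by apply/funext => y; rewrite diff_val.
Qed.

Lemma smooth_near_continuous n m (x : 'rV[R]_n) (f : 'rV[R]_n -> 'rV[R]_m) :
  smooth_near x f -> {for x, continuous f}.
Proof. by move=> [U [_ Ux /(_ 0%N)]]; apply. Qed.

End Smooth.

Section SmoothSpaces.
Context (R : realType).

(* A coordinate chart of T with values in R^n, given by its inverse: a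
   homeomorphism from an open set of R^n onto an open set of T (the values of
   lp_map outside lp_dom are irrelevant). *)
Record local_param (T : topologicalType) (n : nat) := LocalParam {
  lp_dom : set 'rV[R]_n;
  lp_map :> 'rV[R]_n -> T;
  lp_dom_open : open lp_dom;
  lp_continuous : forall a, lp_dom a -> {for a, continuous lp_map};
  lp_inj : forall a b, lp_dom a -> lp_dom b -> lp_map a = lp_map b -> a = b;
  lp_open : forall A, open A -> A `<=` lp_dom -> open (lp_map @` A) }.

(* A locally Euclidean space of dimension n with a smooth atlas, without
   separation axioms. The smooth structure is presented by an atlas that need
   not be maximal. *)
Record smooth_space (n : nat) := SmoothSpace {
  ss_top :> topologicalType;
  ss_atlas : set (local_param ss_top n);
  ss_cover : forall x : ss_top,
    exists c, ss_atlas c /\ exists a, lp_dom c a /\ c a = x;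
  ss_compat : forall c d, ss_atlas c -> ss_atlas d ->
    forall a b, lp_dom c a -> lp_dom d b -> c a = d b ->
    exists g : 'rV[R]_n -> 'rV[R]_n,
      [/\ smooth_near a g, g a = b & \forall a' \near a, c a' = d (g a')] }.

(* f is smooth near x: in every pair of local parametrizations c at x and d at
   f x, the local representation g = d^-1 o f o c is C^oo near c^-1 x. *)
Definition smooth_at n m (M : smooth_space n) (N : smooth_space m)
    (f : M -> N) (x : M) : Prop :=
  forall c d, ss_atlas c -> ss_atlas d ->
  forall a b, lp_dom c a -> lp_dom d b -> c a = x -> d b = f x ->
  exists g : 'rV[R]_n -> 'rV[R]_m,
    [/\ smooth_near a g, g a = b & \forall a' \near a, f (c a') = d (g a')].

Definition smooth_on n m (M : smooth_space n) (N : smooth_space m)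
  (A : set M) (f : M -> N) : Prop := forall x, A x -> smooth_at f x.

Definition smooth n m (M : smooth_space n) (N : smooth_space m)
  (f : M -> N) : Prop := forall x, smooth_at f x.

Definition is_diffeo_on n (M N : smooth_space n) (A : set M) (f : M -> N) :
    Prop :=
  [/\ open A, open (f @` A), smooth_on A f &
      exists g : N -> M,
        (forall x, A x -> g (f x) = x) /\ smooth_on (f @` A) g].

Lemma smooth_at_id n (M : smooth_space n) (x : M) : smooth_at (@id M) x.
Proof.
move=> c d Hc Hd a b ca db <- dbE.
by case: (ss_compat Hc Hd ca db (esym dbE)) => g Hg; exists g.
Qed.

Lemma smooth_at_continuous n m (M : smooth_space n) (N : smooth_space m)
  (f : M -> N) (x : M) : smooth_at f x -> {for x, continuous f}.
Proof.
move=> sf.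
have [c [Hc [a [ca cax]]]] := ss_cover x.
have [d [Hd [b [db dbfx]]]] := ss_cover (f x).
have [g [sg gab fg]] := sf c d Hc Hd a b ca db cax dbfx.
move=> W Wfx.
have gc : {for a, continuous g} by exact: smooth_near_continuous.
have dc : {for g a, continuous d} by rewrite gab; exact: lp_continuous.
have dgc : (d \o g) @ a --> d (g a) by exact: continuous_comp gc dc.
have Wa : \forall a' \near a, W (d (g a')).
  by apply: (dgc W); rewrite gab dbfx.
have H : \forall a' \near a, lp_dom c a' /\ W (f (c a')).
  near=> a'; split.
    by near: a'; apply: open_nbhs_nbhs; split => //; exact: lp_dom_open.
  have -> : f (c a') = d (g a') by near: a'.
  by near: a'.
have [U [oU Ua] sU] : exists2 U, open_nbhs a U &
    U `<=` [set a' | lp_dom c a' /\ W (f (c a'))].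
  by move: H; rewrite /prop_near1 nbhsE.
suff : nbhs x (f @^-1` W) by [].
rewrite nbhsE; exists (c @` U).
  split; last by exists a.
    by apply: (@lp_open _ _ c) => // u /sU [].
by move=> _ [u /sU [_ Wu] <-].
Unshelve. all: by end_near. Qed.

Lemma smooth_at_comp n m p (M : smooth_space n) (N : smooth_space m)
    (K : smooth_space p) (f : M -> N) (h : N -> K) (x : M) :
  smooth_at f x -> smooth_at h (f x) -> smooth_at (h \o f) x.
Proof.
move=> sf sh c e Hc He a b ca eb cax ebx.
have [d [Hd [b1 [db1 db1E]]]] := ss_cover (f x).
have [g1 [sg1 g1a E1]] := sf c d Hc Hd a b1 ca db1 cax db1E.
have [g2 [sg2 g2b E2]] := sh d e Hd He b1 b db1 eb db1E ebx.
exists (fun y => g2 (g1 y)); split.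
- by apply: smooth_near_comp => //; rewrite g1a.
- by rewrite g1a.
- have g1c : g1 @ a --> g1 a by exact: smooth_near_continuous.
  have E2' : \forall a' \near a, h (d (g1 a')) = e (g2 (g1 a')).
    by apply: (g1c [set y | h (d y) = e (g2 y)]); rewrite g1a; exact: E2.
  by apply: filterS2 E1 E2' => a' /= -> ->.
Qed.

Lemma smooth_at_near n m (M : smooth_space n) (N : smooth_space m)
    (f h : M -> N) (x : M) :
  (\forall y \near x, f y = h y) -> smooth_at f x -> smooth_at h x.
Proof.
move=> fh sf c d Hc Hd a b ca db cax dbx.
have fhx : f x = h x := nbhs_singleton fh.
have [g [sg ga E]] := sf c d Hc Hd a b ca db cax (etrans dbx (esym fhx)).
exists g; split=> //.
have cc : c @ a --> x by rewrite -cax; exact: lp_continuous.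
have E' : \forall a' \near a, f (c a') = h (c a') by exact: (cc [set y | f y = h y]) fh.
by apply: filterS2 E E' => a' /= -> <-.
Qed.

(* A diffeomorphism between open subsets of M. It is stored as a map M -> M
   which is the identity outside its domain, so that equality of transitions is
   equality of the underlying partial maps. *)
Record transition n (M : smooth_space n) := Transition {
  tdom : set M;
  tfun :> M -> M;
  tdiffeo : is_diffeo_on tdom tfun;
  toff : forall x, ~ tdom x -> tfun x = x }.

Definition tcod n (M : smooth_space n) (f : transition M) : set M :=
  f @` tdom f.

Lemma tdom_open n (M : smooth_space n) (f : transition M) : open (tdom f).
Proof. by case: (tdiffeo f). Qed.

Lemma tdom_near n (M : smooth_space n) (f : transition M) x :
  tdom f x -> \forall y \near x, tdom f y.
Proof. by move=> fx; apply: open_nbhs_nbhs; split=> //; exact: tdom_open. Qed.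

Lemma tfun_smooth n (M : smooth_space n) (f : transition M) x :
  tdom f x -> smooth_at f x.
Proof. by move: x; case: (tdiffeo f). Qed.

Lemma tfun_continuous n (M : smooth_space n) (f : transition M) x :
  tdom f x -> {for x, continuous f}.
Proof. by move=> fx; exact/smooth_at_continuous/tfun_smooth. Qed.

Lemma tid_subproof n (M : smooth_space n) : is_diffeo_on setT (@id M).
Proof.
split; [exact: openT| |by move=> x _; exact: smooth_at_id|].
  by rewrite image_id; exact: openT.
by exists id; split=> // x _; exact: smooth_at_id.
Qed.

Definition tid n (M : smooth_space n) : transition M :=
  Transition (tid_subproof M) (fun _ _ => erefl).

Section Comp.
Context (n : nat) (M : smooth_space n) (g f : transition M).

Definition tcomp_dom : set M := tdom f `&` f @^-1` tdom g.

Definition tcomp_fun (x : M) : M := if x \in tcomp_dom then g (f x) else x.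

Lemma tcomp_funE x : tcomp_dom x -> tcomp_fun x = g (f x).
Proof. by move=> xD; rewrite /tcomp_fun mem_set. Qed.

Lemma open_preimage_transition (h : transition M) (A : set M) :
  open A -> open (tdom h `&` h @^-1` A).
Proof.
move=> oA; rewrite openE => x [hx Ahx]; apply: filterI; first exact: tdom_near.
by apply: (tfun_continuous hx); exact: open_nbhs_nbhs.
Qed.

Lemma open_image_transition (h : transition M) (A : set M) :
  open A -> A `<=` tdom h -> open (h @` A).
Proof.
move=> oA sA; have [_ oc _ [k [kK sk]]] := tdiffeo h.
rewrite openE => _ [x Ax <-].
have hx := sA x Ax.
have kc : k @ h x --> k (h x).
  by apply: smooth_at_continuous; apply: sk; exists x.
have H1 : \forall y \near h x, (h @` tdom h) y.
  by apply: open_nbhs_nbhs; split=> //; exists x.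
have H2 : \forall y \near h x, A (k y).
  by apply: (kc A); rewrite kK //; exact: open_nbhs_nbhs.
by apply: filterS2 H1 H2 => y [z hz <-]; rewrite kK // => Az; exists z.
Qed.

Lemma tcomp_subproof : is_diffeo_on tcomp_dom tcomp_fun.
Proof.
have oD : open tcomp_dom by exact/open_preimage_transition/tdom_open.
have [_ _ _ [kf [kfK skf]]] := tdiffeo f.
have [_ _ _ [kg [kgK skg]]] := tdiffeo g.
have imE : tcomp_fun @` tcomp_dom = g @` (f @` tcomp_dom).
  apply/seteqP; split=> [_ [x Dx <-]|_ [_ [x Dx <-] <-]].
    by rewrite tcomp_funE //; exists (f x) => //; exists x.
  by exists x => //; exact: tcomp_funE.
split=> //.
- rewrite imE; apply: open_image_transition.
    by apply: open_image_transition => // x [].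
  by move=> _ [x [_ gx] <-].
- move=> x Dx; apply: (@smooth_at_near _ _ _ _ (g \o f)).
    near=> y; rewrite tcomp_funE //; near: y; exact: open_nbhs_nbhs.
  by case: Dx => fx gx; apply: smooth_at_comp; exact: tfun_smooth.
- exists (kf \o kg); split=> [x Dx|_ [x Dx <-]].
    by rewrite tcomp_funE //=; case: Dx => fx gx; rewrite kgK // kfK.
  rewrite tcomp_funE //; case: Dx => fx gx; apply: smooth_at_comp.
    by apply: skg; exists (f x).
  by rewrite kgK //; apply: skf; exists x.
Unshelve. all: by end_near. Qed.

Lemma tcomp_off x : ~ tcomp_dom x -> tcomp_fun x = x.
Proof. by move=> xD; rewrite /tcomp_fun memNset. Qed.

(* The composition g o f, with domain f^-1 (tdom g). *)
Definition tcomp : transition M := Transition tcomp_subproof tcomp_off.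

End Comp.

Section Inv.
Context (n : nat) (M : smooth_space n) (f : transition M).

Lemma tinv_ex : exists g : M -> M, [/\ forall x, tdom f x -> g (f x) = x,
  smooth_on (tcod f) g & forall y, ~ tcod f y -> g y = y].
Proof.
have [_ oc _ [k [kK sk]]] := tdiffeo f.
exists (fun y => if y \in tcod f then k y else y); split.
- by move=> x fx; rewrite mem_set ?kK //; exists x.
- move=> y cy; apply: (@smooth_at_near _ _ _ _ k); last exact: sk.
  near=> z; rewrite mem_set //; near: z; exact: open_nbhs_nbhs.
- by move=> y cy; rewrite memNset.
Unshelve. all: by end_near. Qed.

Definition tinv_fun : M -> M := sval (cid tinv_ex).

Lemma tinvK x : tdom f x -> tinv_fun (f x) = x.
Proof. by case: (svalP (cid tinv_ex)) => gK _ _; exact: gK. Qed.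

Lemma tinv_subproof : is_diffeo_on (tcod f) tinv_fun.
Proof.
have [od oc sf _] := tdiffeo f.
have imE : tinv_fun @` tcod f = tdom f.
  apply/seteqP; split=> [_ [_ [x fx <-] <-]|x fx]; first by rewrite tinvK.
  by exists (f x); [exists x|rewrite tinvK].
split=> //; first by rewrite imE.
  by case: (svalP (cid tinv_ex)).
exists f; rewrite imE; split=> // _ [x fx <-].
by rewrite tinvK.
Qed.

Lemma tinv_off y : ~ tcod f y -> tinv_fun y = y.
Proof. by case: (svalP (cid tinv_ex)) => _ _; exact. Qed.

Definition tinv : transition M := Transition tinv_subproof tinv_off.

End Inv.

(* The germ at x of a transition f defined at x. *)
Definition germ n (M : smooth_space n) (x : M) (f : transition M) :
    set (transition M) :=
  [set g | tdom g x /\ \forall y \near x, g y = f y].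

Lemma germ_eqP n (M : smooth_space n) (x : M) (f g : transition M) :
  tdom f x -> tdom g x ->
  germ x f = germ x g <-> \forall y \near x, f y = g y.
Proof.
move=> fx gx; split=> [E|fg].
  have : germ x f f by split=> //; exact: nearW.
  by rewrite E => -[].
apply/seteqP; split=> h [hx hf]; split=> //.
  by apply: filterS2 hf fg => y /= -> ->.
by apply: filterS2 hf fg => y /= -> ->.
Qed.

End SmoothSpaces.

Section Groupoids.
Context (R : realType).

(* A groupoid whose objects and arrows form smooth spaces. Smoothness of the
   structure maps is not recorded: it plays no role in the notion of a
   homomorphism. *)
Record smooth_groupoid (n m : nat) := SmoothGroupoid {
  gobj : smooth_space R n;
  garr : smooth_space R m;
  gsrc : garr -> gobj;
  gtgt : garr -> gobj;
  gunit : gobj -> garr;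
  ginv : garr -> garr;
  gmul : forall b a : garr, gsrc b = gtgt a -> garr;
  gsrc_unit : forall x, gsrc (gunit x) = x;
  gtgt_unit : forall x, gtgt (gunit x) = x;
  gsrc_mul : forall b a e, gsrc (@gmul b a e) = gsrc a;
  gtgt_mul : forall b a e, gtgt (@gmul b a e) = gtgt b;
  gsrc_inv : forall a, gsrc (ginv a) = gtgt a;
  gtgt_inv : forall a, gtgt (ginv a) = gsrc a;
  gmul1l : forall a e, @gmul (gunit (gtgt a)) a e = a;
  gmul1r : forall a e, @gmul a (gunit (gsrc a)) e = a;
  gmulA : forall c b a e1 e2 e3 e4,
    @gmul c (@gmul b a e1) e2 = @gmul (@gmul c b e3) a e4;
  gmulVl : forall a e, @gmul (ginv a) a e = gunit (gsrc a);
  gmulVr : forall a e, @gmul a (ginv a) e = gunit (gtgt a) }.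

Record groupoid_hom n m n' m' (G : smooth_groupoid n m)
    (H : smooth_groupoid n' m') := GroupoidHom {
  hobj : gobj G -> gobj H;
  harr : garr G -> garr H;
  hobj_smooth : smooth hobj;
  harr_smooth : smooth harr;
  hom_src : forall a, gsrc (harr a) = hobj (gsrc a);
  hom_tgt : forall a, gtgt (harr a) = hobj (gtgt a);
  hom_unit : forall x, harr (gunit x) = gunit (hobj x);
  hom_mul : forall b a (e : gsrc b = gtgt a)
    (e' : gsrc (harr b) = gtgt (harr a)),
    harr (gmul e) = gmul e' }.

Section OrbitSpace.
Context (n m : nat) (G : smooth_groupoid n m).

Definition orbit_of (x : gobj G) : set (gobj G) :=
  [set y | exists a, gsrc a = x /\ gtgt a = y].

Definition orbit_space := {A : set (gobj G) | exists x, A = orbit_of x}.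

Lemma orbit_space_eq (A B : orbit_space) : sval A = sval B -> A = B.
Proof.
case: A B => [A HA] [B HB] /= E; subst B.
by congr exist; exact: Prop_irrelevance.
Qed.

Definition to_orbit (x : gobj G) : orbit_space :=
  exist _ (orbit_of x) (ex_intro _ x erefl).

Definition orbit_repr (A : orbit_space) : gobj G := sval (cid (svalP A)).

Lemma orbit_reprK A : to_orbit (orbit_repr A) = A.
Proof.
by apply: orbit_space_eq; rewrite /= /orbit_repr; case: cid.
Qed.

Lemma orbit_repr_to_orbit x :
  exists a, gsrc a = orbit_repr (to_orbit x) /\ gtgt a = x.
Proof.
have : orbit_of (orbit_repr (to_orbit x)) x.
  have -> : orbit_of (orbit_repr (to_orbit x)) = orbit_of x.
    by have := congr1 sval (orbit_reprK (to_orbit x)).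
  by exists (gunit x); rewrite gsrc_unit gtgt_unit.
by [].
Qed.

End OrbitSpace.

(* |phi| : |G| -> |H|; it does not depend on the chosen representatives. *)
Definition hom_orbit n m n' m' (G : smooth_groupoid n m)
    (H : smooth_groupoid n' m') (phi : groupoid_hom G H)
    (A : orbit_space G) : orbit_space H :=
  to_orbit (hobj phi (orbit_repr A)).

Lemma hom_orbitE n m n' m' (G : smooth_groupoid n m)
    (H : smooth_groupoid n' m') (phi : groupoid_hom G H) x :
  hom_orbit phi (to_orbit x) = to_orbit (hobj phi x).
Proof.
have [a [as_ at_]] := orbit_repr_to_orbit x.
apply: orbit_space_eq => /=; rewrite -as_ -[in RHS]at_ -hom_src -hom_tgt.
move: (harr phi a) => b; apply/seteqP; split=> y [c [cs ct]].
  have e : gsrc c = gtgt (ginv b) by rewrite gtgt_inv.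
  by exists (gmul e); rewrite gsrc_mul gtgt_mul gsrc_inv.
have e : gsrc c = gtgt b by [].
by exists (gmul e); rewrite gsrc_mul gtgt_mul.
Qed.

End Groupoids.

Section GermGroupoid.
Context (R : realType) (n : nat) (M : smooth_space R n) (Q : Type) (p : M -> Q).

Definition preserving : set (transition M) :=
  [set f | forall x, tdom f x -> p (f x) = p x].

Lemma preserving_id : preserving (tid M).
Proof. by []. Qed.

Lemma preserving_comp f g :
  preserving f -> preserving g -> preserving (tcomp g f).
Proof.
move=> pf pg x Dx; have [fx gx] := Dx.
by rewrite /= tcomp_funE // pg // pf.
Qed.

Lemma preserving_inv f : preserving f -> preserving (tinv f).
Proof. by move=> pf _ [x fx <-]; rewrite /= tinvK // pf. Qed.

(* Germs germ_x f; the base point x is recorded, so that germs at different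
   points are different. *)
Record germ_arrow := GermArrow {
  asrc : M;
  agerm : set (transition M);
  agermP : exists f, [/\ preserving f, tdom f asrc & agerm = germ asrc f] }.

Lemma mk_germ_subproof f x : preserving f /\ tdom f x ->
  exists h, [/\ preserving h, tdom h x & germ x f = germ x h].
Proof. by move=> [pf fx]; exists f. Qed.

Definition unit_germ (x : M) : germ_arrow :=
  GermArrow (mk_germ_subproof (conj preserving_id (I : tdom (tid M) x))).

(* germ_x f as an arrow; the value unit_germ x is only a default for the case
   that f is not defined at x or does not preserve p. *)
Definition mk_germ (x : M) (f : transition M) : germ_arrow :=
  match pselect (preserving f /\ tdom f x) with
  | left H => GermArrow (mk_germ_subproof H)
  | right _ => unit_germ x
  end.

Lemma asrc_mk x f : asrc (mk_germ x f) = x.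
Proof. by rewrite /mk_germ; case: pselect. Qed.

Lemma agerm_mk x f : preserving f -> tdom f x ->
  agerm (mk_germ x f) = germ x f.
Proof. by move=> pf fx; rewrite /mk_germ; case: pselect => // -[]. Qed.

Lemma germ_arrow_eq (a b : germ_arrow) :
  asrc a = asrc b -> agerm a = agerm b -> a = b.
Proof.
case: a => x A HA; case: b => y B HB /= xy AB; subst y; subst B.
by congr GermArrow; exact: Prop_irrelevance.
Qed.

Lemma mk_germ_eqP x f g : preserving f -> tdom f x -> preserving g ->
  tdom g x -> mk_germ x f = mk_germ x g <-> \forall y \near x, f y = g y.
Proof.
move=> pf fx pg gx; rewrite -germ_eqP //; split=> E.
  by rewrite -(agerm_mk pf fx) -(agerm_mk pg gx) E.
by apply: germ_arrow_eq; rewrite ?asrc_mk // !agerm_mk.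
Qed.

Definition arep (a : germ_arrow) : transition M := sval (cid (agermP a)).

Lemma arep_preserving a : preserving (arep a).
Proof. by case: (svalP (cid (agermP a))). Qed.

Lemma arep_dom a : tdom (arep a) (asrc a).
Proof. by case: (svalP (cid (agermP a))). Qed.

Lemma arepK a : mk_germ (asrc a) (arep a) = a.
Proof.
apply: germ_arrow_eq; first by rewrite asrc_mk.
rewrite agerm_mk; [|exact: arep_preserving|exact: arep_dom].
by case: (svalP (cid (agermP a))).
Qed.

Lemma germ_arrowP (a : germ_arrow) :
  exists x f, [/\ preserving f, tdom f x & a = mk_germ x f].
Proof.
exists (asrc a), (arep a); split; last by rewrite arepK.
- exact: arep_preserving.
- exact: arep_dom.
Qed.

Lemma arep_mk_near x f : preserving f -> tdom f x ->
  tdom (arep (mk_germ x f)) x /\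
  \forall y \near x, arep (mk_germ x f) y = f y.
Proof.
move=> pf fx; have d := arep_dom (mk_germ x f); rewrite asrc_mk in d.
split=> //; apply/mk_germ_eqP => //; first exact: arep_preserving.
by have := arepK (mk_germ x f); rewrite asrc_mk.
Qed.

Definition atgt (a : germ_arrow) : M := arep a (asrc a).

Lemma atgt_mk x f : preserving f -> tdom f x -> atgt (mk_germ x f) = f x.
Proof.
move=> pf fx; have [_ E] := arep_mk_near pf fx.
by rewrite /atgt asrc_mk; exact: nbhs_singleton E.
Qed.

Definition amul (b a : germ_arrow) : germ_arrow :=
  mk_germ (asrc a) (tcomp (arep b) (arep a)).

Lemma amul_mk x f g : preserving f -> tdom f x -> preserving g ->
  tdom g (f x) -> amul (mk_germ (f x) g) (mk_germ x f) = mk_germ x (tcomp g f).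
Proof.
move=> pf fx pg gfx; rewrite /amul asrc_mk.
have [df Ef] := arep_mk_near pf fx.
have [dg Eg] := arep_mk_near pg gfx.
move: (@arep_preserving (mk_germ x f)) (@arep_preserving (mk_germ (f x) g)).
move: df Ef dg Eg; move: (arep (mk_germ x f)) (arep (mk_germ (f x) g)) => f' g'.
move=> df Ef dg Eg pf' pg'.
have fx' : f' x = f x by exact: nbhs_singleton Ef.
have D' : tcomp_dom g' f' x by split=> //=; rewrite /preimage /= fx'.
have D : tcomp_dom g f x by split.
apply/mk_germ_eqP => //; [exact: preserving_comp|exact: preserving_comp|].
have Eg' : \forall y \near x, g' (f y) = g (f y).
  exact: (tfun_continuous fx Eg).
have N' := @tdom_near _ _ _ (tcomp g' f') _ D'.
have N := @tdom_near _ _ _ (tcomp g f) _ D.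
near=> y; rewrite /= !tcomp_funE; [|by near: y..].
have -> : f' y = f y by near: y.
by near: y.
Unshelve. all: by end_near. Qed.

Definition ainv (a : germ_arrow) : germ_arrow := mk_germ (atgt a) (tinv (arep a)).

Lemma atgt_dom_inv a : tdom (tinv (arep a)) (atgt a).
Proof. by exists (asrc a) => //; exact: arep_dom. Qed.

Lemma composable (b a : germ_arrow) : asrc b = atgt a ->
  exists x f g, [/\ preserving f, tdom f x, preserving g & tdom g (f x)] /\
    a = mk_germ x f /\ b = mk_germ (f x) g.
Proof.
move=> e; exists (asrc a), (arep a), (arep b); split; first split.
- exact: arep_preserving.
- exact: arep_dom.
- exact: arep_preserving.
- by have := arep_dom b; rewrite e.
- by split; [|have := arepK b; rewrite e /atgt => {1}<-]; rewrite ?arepK.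
Qed.

Lemma amul_src b a : asrc (amul b a) = asrc a.
Proof. exact: asrc_mk. Qed.

Lemma amul_tgt b a : asrc b = atgt a -> atgt (amul b a) = atgt b.
Proof.
move=> /composable [x [f [g [[pf fx pg gx] [-> ->]]]]].
rewrite amul_mk // atgt_mk //; last exact: preserving_comp.
by rewrite /= tcomp_funE // atgt_mk.
Qed.

Lemma ainv_src a : asrc (ainv a) = atgt a.
Proof. exact: asrc_mk. Qed.

Lemma ainv_tgt a : atgt (ainv a) = asrc a.
Proof.
rewrite atgt_mk; [|exact/preserving_inv/arep_preserving|exact: atgt_dom_inv].
by rewrite /= tinvK //; exact: arep_dom.
Qed.

Lemma unit_germE x : unit_germ x = mk_germ x (tid M).
Proof.
apply: germ_arrow_eq; first by rewrite asrc_mk.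
by rewrite agerm_mk.
Qed.

Lemma unit_tgt x : atgt (unit_germ x) = x.
Proof. by rewrite unit_germE atgt_mk. Qed.

Lemma amul1l a : amul (unit_germ (atgt a)) a = a.
Proof.
have [x [f [pf fx ->]]] := germ_arrowP a.
rewrite atgt_mk // unit_germE amul_mk //.
apply/mk_germ_eqP => //; first exact: preserving_comp.
have N := @tdom_near _ _ _ (tcomp (tid M) f) _ (conj fx I).
by near=> y; rewrite /= tcomp_funE //; near: y.
Unshelve. all: by end_near. Qed.

Lemma amul1r a : amul a (unit_germ (asrc a)) = a.
Proof.
have [x [f [pf fx ->]]] := germ_arrowP a.
rewrite asrc_mk // unit_germE; have := @amul_mk x (tid M) f.
move=> -> //; apply/mk_germ_eqP => //; first exact: preserving_comp.
have N := @tdom_near _ _ _ (tcomp f (tid M)) _ (conj I fx).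
by near=> y; rewrite /= tcomp_funE //; near: y.
Unshelve. all: by end_near. Qed.

Lemma amulA c b a : asrc b = atgt a -> asrc c = atgt b ->
  amul c (amul b a) = amul (amul c b) a.
Proof.
move=> /composable [x [f [g [[pf fx pg gx] [-> ->]]]]].
rewrite atgt_mk // => ec.
have [h [ph hx ->]] : exists h, [/\ preserving h, tdom h (g (f x)) &
    c = mk_germ (g (f x)) h].
  exists (arep c); rewrite -ec; split; last by rewrite arepK.
  - exact: arep_preserving.
  - exact: arep_dom.
have E : g (f x) = tcomp g f x by rewrite /= tcomp_funE.
have pgf := preserving_comp pf pg.
have phg := preserving_comp pg ph.
rewrite (amul_mk pf fx pg gx) {1}E amul_mk -?E // amul_mk // amul_mk //.
have D1 : tdom (tcomp h (tcomp g f)) x 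
  by split; [split|exact: (eq_ind _ (tdom h) hx _ E)].
have D2 : tdom (tcomp (tcomp h g) f) x by split.
apply/mk_germ_eqP => //; [exact: preserving_comp|exact: preserving_comp|].
have N1 := tdom_near D1; have N2 := tdom_near D2.
near=> y.
have [d1 d1'] : tdom (tcomp h (tcomp g f)) y by near: y.
have [d2 d2'] : tdom (tcomp (tcomp h g) f) y by near: y.
by rewrite /= !tcomp_funE //= !tcomp_funE.
Unshelve. all: by end_near. Qed.

Lemma amulVl a : amul (ainv a) a = unit_germ (asrc a).
Proof.
have pa := @arep_preserving a; have da := arep_dom a.
have pi := preserving_inv pa; have di := atgt_dom_inv a.
rewrite unit_germE -[X in amul _ X]arepK /ainv /atgt amul_mk //.
apply/mk_germ_eqP => //; first exact: preserving_comp.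
have N := @tdom_near _ _ _ (tcomp (tinv (arep a)) (arep a)) _ (conj da di).
near=> y; have D : tcomp_dom (tinv (arep a)) (arep a) y by near: y.
by rewrite /= tcomp_funE //= tinvK //; case: D.
Unshelve. all: by end_near. Qed.

Lemma amulVr a : amul a (ainv a) = unit_germ (atgt a).
Proof.
have pa := @arep_preserving a; have da := arep_dom a.
have pi := preserving_inv pa; have di := atgt_dom_inv a.
have E : tinv (arep a) (atgt a) = asrc a by rewrite /= tinvK.
rewrite unit_germE -{1}[a]arepK /ainv -{1}E amul_mk // ?E //.
have D0 : tdom (tcomp (arep a) (tinv (arep a))) (atgt a).
  by split=> //; exact: (eq_ind _ (tdom (arep a)) da _ (esym E)).
apply/mk_germ_eqP => //; first exact: preserving_comp.
have N := tdom_near D0.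
near=> y; have D : tcomp_dom (arep a) (tinv (arep a)) y by near: y.
by rewrite /= tcomp_funE //=; case: D => -[z dz <-] _ /=; rewrite tinvK.
Unshelve. all: by end_near. Qed.

HB.instance Definition _ := gen_eqMixin germ_arrow.
HB.instance Definition _ := gen_choiceMixin germ_arrow.

(* A is open iff {x | germ_x f \in A} is open for each f; equivalently, the sets
   {germ_x f | x \in U} with U open form a basis. *)
Definition germ_open : set_system germ_arrow :=
  [set A | forall f, preserving f -> open [set x | tdom f x /\ A (mk_germ x f)]].

Lemma germ_openT : germ_open setT.
Proof.
move=> f pf; rewrite (_ : [set x | _] = tdom f); first exact: tdom_open.
by apply/seteqP; split=> x // [].
Qed.

Lemma germ_openI : setI_closed germ_open.
Proof.
move=> A B oA oB f pf.
rewrite (_ : [set x | _] = [set x | tdom f x /\ A (mk_germ x f)] `&`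
  [set x | tdom f x /\ B (mk_germ x f)]); first by apply: openI; auto.
by apply/seteqP; split=> [x [? []]|x [[? ?] [? ?]]].
Qed.

Lemma germ_open_bigU (I : Type) (F : I -> set germ_arrow) :
  (forall i, germ_open (F i)) -> germ_open (\bigcup_i F i).
Proof.
move=> oF f pf.
rewrite (_ : [set x | _] = \bigcup_i [set x | tdom f x /\ F i (mk_germ x f)]).
  by apply: bigcup_open => i _; exact: oF.
by apply/seteqP; split=> [x [? [i _ ?]]|x [i _ [? ?]]]; [exists i|split=> //; exists i].
Qed.

HB.instance Definition _ :=
  isOpenTopological.Build germ_arrow germ_openT germ_openI germ_open_bigU.

Section GermParam.
Context (f : transition M) (pf : preserving f) (c : local_param R M n).

Definition germ_param_dom : set 'rV[R]_n := lp_dom c `&` c @^-1` tdom f.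

Definition germ_param_map (a : 'rV[R]_n) : germ_arrow := mk_germ (c a) f.

Lemma germ_openE (A : set germ_arrow) : open A = germ_open A.
Proof. by []. Qed.

Lemma lp_open_preimage (A : set M) : open A -> open (lp_dom c `&` c @^-1` A).
Proof.
move=> oA; rewrite openE => a [ca Aa]; apply: filterI.
  by apply: open_nbhs_nbhs; split=> //; exact: lp_dom_open.
have cc : c @ a --> c a := lp_continuous ca.
by apply: (cc A); exact: open_nbhs_nbhs.
Qed.

Lemma germ_param_open_dom : open germ_param_dom.
Proof. exact/lp_open_preimage/tdom_open. Qed.

Lemma germ_param_continuous a : germ_param_dom a ->
  {for a, continuous germ_param_map}.
Proof.
move=> [ca fa] W; rewrite nbhsE => -[U [oU Ua] sU].
have o := oU : germ_open U.
have := lp_open_preimage (o f pf).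
set D := _ `&` _ => oD.
have : nbhs a D by apply: open_nbhs_nbhs.
by apply: filterS => b [_ [_ ?]]; exact: sU.
Qed.

Lemma germ_param_inj a b : germ_param_dom a -> germ_param_dom b ->
  germ_param_map a = germ_param_map b -> a = b.
Proof.
move=> [ca _] [cb _] /(congr1 asrc); rewrite !asrc_mk; exact: lp_inj.
Qed.

Lemma germ_param_open A : open A -> A `<=` germ_param_dom ->
  open (germ_param_map @` A).
Proof.
move=> oA sA; rewrite germ_openE => g pg.
rewrite openE => x [gx [a Aa E]].
have xE : c a = x by have := congr1 asrc E; rewrite !asrc_mk.
have [ca fa] := sA a Aa; rewrite /preimage /= xE in fa.
have Eg : \forall y \near x, f y = g y.
  by apply/mk_germ_eqP => //; rewrite -E -xE.
have ocA : open (c @` A) by apply: (@lp_open _ _ _ c) => // b /sA [].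
have N1 : \forall y \near x, (c @` A) y.
  by apply: open_nbhs_nbhs; split=> //; exists a.
have N2 := tdom_near gx; have N3 := tdom_near fa.
have N4 := near_join Eg.
near=> y; split; first by near: y.
have [b Ab yE] : (c @` A) y by near: y.
exists b => //; rewrite /germ_param_map yE.
by apply/mk_germ_eqP => //; near: y.
Unshelve. all: by end_near. Qed.

Definition germ_param : local_param R germ_arrow n :=
  LocalParam germ_param_open_dom germ_param_continuous germ_param_inj
    germ_param_open.

End GermParam.

Definition germ_atlas : set (local_param R germ_arrow n) :=
  [set e | exists f (pf : preserving f) c, ss_atlas c /\ e = germ_param pf c].

Lemma germ_cover (a : germ_arrow) :
  exists e, germ_atlas e /\ exists b, lp_dom e b /\ e b = a.
Proof.
have [x [f [pf fx ->]]] := germ_arrowP a.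
have [c [Hc [b [cb bx]]]] := ss_cover x.
exists (germ_param pf c); split; first by exists f, pf, c.
by exists b; split; [split=> //; rewrite /preimage /= bx|rewrite /= /germ_param_map bx].
Qed.

Lemma germ_compat c d : germ_atlas c -> germ_atlas d ->
  forall a b, lp_dom c a -> lp_dom d b -> c a = d b ->
  exists g : 'rV[R]_n -> 'rV[R]_n,
    [/\ smooth_near a g, g a = b & \forall a' \near a, c a' = d (g a')].
Proof.
move=> [f [pf [c0 [Hc ->]]]] [h [ph [d0 [Hd ->]]]] a b [/= ca fa] [/= db hb].
rewrite /germ_param_map => E.
have xE : c0 a = d0 b by have := congr1 asrc E; rewrite !asrc_mk.
have [g [sg gab Eg]] := ss_compat Hc Hd ca db xE.
exists g; split=> //.
rewrite /preimage /= -xE in hb; rewrite -xE in E.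
have Efh : \forall y \near c0 a, f y = h y by apply/mk_germ_eqP.
have N1 := tdom_near fa; have N2 := tdom_near hb; have N3 := near_join Efh.
have cc : c0 @ a --> c0 a := lp_continuous ca.
have C1 := cc _ N1; have C2 := cc _ N2; have C3 := cc _ N3.
near=> a'.
have <- : c0 a' = d0 (g a') by near: a'.
apply/mk_germ_eqP => //.
- by near: a'; exact: C1.
- by near: a'; exact: C2.
- by near: a'; exact: C3.
Unshelve. all: by end_near. Qed.

Definition germ_space : smooth_space R n := SmoothSpace germ_cover germ_compat.

Lemma amulA_subproof c b a (e1 : asrc b = atgt a)
    (e2 : asrc c = atgt (amul b a)) (e3 : asrc c = atgt b)
    (e4 : asrc (amul c b) = atgt a) :
  amul c (amul b a) = amul (amul c b) a.
Proof. exact: amulA. Qed.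

Definition germ_groupoid : smooth_groupoid R n n :=
  @SmoothGroupoid R n n M germ_space asrc atgt unit_germ ainv
    (fun b a _ => amul b a)
    (fun _ => erefl) unit_tgt (fun b a _ => amul_src b a) amul_tgt
    ainv_src ainv_tgt (fun a _ => amul1l a) (fun a _ => amul1r a)
    amulA_subproof (fun a _ => amulVl a) (fun a _ => amulVr a).

End GermGroupoid.

Section Coproduct.
Context (R : realType) (n : nat) (I : choiceType) (X : I -> smooth_space R n).

Definition coprod_top : topologicalType := {i : I & X i}.

Definition coprod_in (i : I) (x : X i) : coprod_top := existT X i x.

Lemma coprod_in_inj (i : I) (x y : X i) :
  coprod_in x = coprod_in y -> x = y.
Proof.
by move=> E; have := projT2_eq E; rewrite (eq_irrelevance (projT1_eq E) erefl).
Qed.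

Section CoprodParam.
Context (i : I) (c : local_param R (X i) n).

Lemma coprod_param_continuous a : lp_dom c a ->
  {for a, continuous (fun b => coprod_in (c b))}.
Proof. by move=> ca; apply: (continuous_comp (lp_continuous ca)). Qed.

Lemma coprod_param_inj a b : lp_dom c a -> lp_dom c b ->
  coprod_in (c a) = coprod_in (c b) -> a = b.
Proof. by move=> ca cb E; apply: (lp_inj ca cb); exact: coprod_in_inj. Qed.

Lemma coprod_param_open A : open A -> A `<=` lp_dom c ->
  open ((fun b => coprod_in (c b)) @` A).
Proof.
move=> oA sA.
rewrite -(image_comp c (@coprod_in i)).
exact/existT_open_map/lp_open.
Qed.

Definition coprod_param : local_param R coprod_top n :=
  LocalParam (@lp_dom_open _ _ _ c) coprod_param_continuous coprod_param_inj
    coprod_param_open.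

End CoprodParam.

Definition coprod_atlas : set (local_param R coprod_top n) :=
  [set e | exists i (c : local_param R (X i) n), ss_atlas c /\ e = coprod_param c].

Lemma coprod_cover (x : coprod_top) :
  exists e, coprod_atlas e /\ exists b, lp_dom e b /\ e b = x.
Proof.
case: x => i x; have [c [Hc [a [ca ax]]]] := ss_cover x.
exists (coprod_param c); split; first by exists i, c.
by exists a; rewrite /= ax.
Qed.

Lemma coprod_compat c d : coprod_atlas c -> coprod_atlas d ->
  forall a b, lp_dom c a -> lp_dom d b -> c a = d b ->
  exists g : 'rV[R]_n -> 'rV[R]_n,
    [/\ smooth_near a g, g a = b & \forall a' \near a, c a' = d (g a')].
Proof.
move=> [i [c0 [Hc ->]]] [j [d0 [Hd ->]]] a b /= ca db E.
have ij : i = j by exact: (congr1 (@projT1 _ _) E).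
subst j; have {}E := coprod_in_inj E.
have [g [sg gab Eg]] := ss_compat Hc Hd ca db E.
exists g; split=> //.
by apply: filterS Eg => a' ->.
Qed.

Definition coprod : smooth_space R n := SmoothSpace coprod_cover coprod_compat.

End Coproduct.

Section Orbifolds.
Context (R : realType).

Definition paracompact (T : topologicalType) : Prop :=
  forall C : set (set T), C `<=` open -> \bigcup_(A in C) A = setT ->
  exists D : set (set T), [/\ D `<=` open, \bigcup_(B in D) B = setT,
    (forall B, D B -> exists2 A, C A & B `<=` A) &
    forall x : T, exists2 N, nbhs x N &
      finite_set [set B | D B /\ B `&` N !=set0]].

Record manifold (n : nat) := Manifold {
  mf_space :> smooth_space R n;
  mf_hausdorff : hausdorff_space mf_space;
  mf_paracompact : paracompact mf_space }.

(* Connected spaces are nonempty. The fields oc_orbit and oc_homeo say that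
   oc_map induces a bijection, resp. a homeomorphism, from the orbit space of
   oc_group (with the quotient topology) onto the open set range oc_map. *)
Record orb_chart (Q : topologicalType) (n : nat) := OrbChart {
  oc_mfd :> manifold n;
  oc_connected : connected [set: oc_mfd];
  oc_nonempty : [set: oc_mfd] !=set0;
  oc_group : set (oc_mfd -> oc_mfd);
  oc_finite : finite_set oc_group;
  oc_smooth : forall g, oc_group g -> smooth g;
  oc_id : oc_group id;
  oc_comp : forall g h, oc_group g -> oc_group h -> oc_group (g \o h);
  oc_inv : forall g, oc_group g ->
    exists h, [/\ oc_group h, cancel g h & cancel h g];
  oc_map : oc_mfd -> Q;
  oc_open : open (range oc_map);
  oc_orbit : forall x y,
    oc_map x = oc_map y <-> exists2 g, oc_group g & g x = y;
  oc_homeo : forall A : set Q, A `<=` range oc_map ->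
    (open A <-> open (oc_map @^-1` A)) }.

Section Charts.
Context (Q : topologicalType) (n : nat).
Implicit Types C D : orb_chart Q n.

(* h restricts to a diffeomorphism from A onto h @` A. *)
Definition change_of_charts C D (A : set C) (h : C -> D) : Prop :=
  [/\ A !=set0, connected A, connected (h @` A), is_diffeo_on A h &
      forall x, A x -> oc_map (h x) = oc_map x].

Definition compatible C D : Prop :=
  forall (x : C) (y : D), oc_map x = oc_map y ->
  exists (A : set C) (h : C -> D),
    [/\ A x, (h @` A) y & change_of_charts A h].

(* Between manifolds of equal dimension, an embedding is a diffeomorphism onto
   an open subset. *)
Definition chart_embedding C D (mu : C -> D) : Prop :=
  is_diffeo_on setT mu /\ forall x, oc_map (mu x) = oc_map x.

(* Up to the identification mu of C with the open subset range mu of D, the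
   chart C is the restriction (S, G_S, phi|_S) of D = (W, G, phi) to
   S = range mu, where G_S consists of the g|_S with g in G and g(S) = S. *)
Definition chart_restriction C D (mu : C -> D) : Prop :=
  [/\ chart_embedding mu,
      forall h : C -> C, oc_group h ->
        exists2 g : D -> D, oc_group g & forall x, mu (h x) = g (mu x) &
      forall g : D -> D, oc_group g -> g @` range mu = range mu ->
        exists2 h : C -> C, oc_group h & forall x, mu (h x) = g (mu x)].

End Charts.

Inductive version := Paracompact | SecondCountable.

Definition version_space (v : version) (Q : topologicalType) : Prop :=
  match v with
  | Paracompact => paracompact Q
  | SecondCountable => @second_countable Q
  end.

(* Sets of charts are plain predicates, since orb_chart Q n is too large for
   the universe of classical_sets.set. *)
Definition is_atlas (v : version) (Q : topologicalType) (n : nat)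
    (A : orb_chart Q n -> Prop) : Prop :=
  [/\ forall C D, A C -> A D -> compatible C D,
      (forall q, exists2 C, A C & exists x : C, oc_map x = q) &
      v = SecondCountable ->
        exists e : orb_chart Q n -> nat,
          forall C D, A C -> A D -> e C = e D -> C = D].

Definition atlas_equiv v (Q : topologicalType) n (A B : orb_chart Q n -> Prop) :
  Prop := is_atlas v (fun C => A C \/ B C).

(* An equivalence class of atlases. *)
Record orb_structure (v : version) (Q : topologicalType) (n : nat) :=
  OrbStructure {
    os_reps :> (orb_chart Q n -> Prop) -> Prop;
    os_class : exists2 A, is_atlas v A &
      forall B, os_reps B <-> is_atlas v B /\ atlas_equiv v A B }.

Record orbifold (v : version) (n : nat) := Orbifold {
  ob_space :> topologicalType;
  ob_hausdorff : hausdorff_space ob_space;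
  ob_version : version_space v ob_space;
  ob_structure : orb_structure v ob_space n }.

Definition chart_of v n (Q : orbifold v n) (C : orb_chart Q n) : Prop :=
  exists2 A, ob_structure Q A & A C.

(* A representative of the orbifold structure, as an indexed family. *)
Record representative v n (Q : orbifold v n) := Representative {
  rp_index : choiceType;
  rp_chart :> rp_index -> orb_chart Q n;
  rp_inj : injective rp_chart;
  rp_atlas : ob_structure Q (fun C => exists i, rp_chart i = C) }.

Section AtlasGroupoid.
Context (v : version) (n : nat) (Q : orbifold v n) (V : representative Q).

Definition total : smooth_space R n :=
  coprod (fun i : rp_index V => mf_space (V i)).

Definition in_total (i : rp_index V) (x : V i) : total :=
  @coprod_in R n _ (fun i : rp_index V => mf_space (V i)) i x.

Definition proj_total (x : total) : Q := oc_map (projT2 x).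

Definition Psi : set (transition total) := preserving proj_total.

Definition atlas_groupoid : smooth_groupoid R n n := germ_groupoid proj_total.

Definition alpha (A : orbit_space atlas_groupoid) : Q :=
  proj_total (orbit_repr A).

Lemma alphaE x : alpha (to_orbit x) = proj_total x.
Proof.
have [a [s_a t_a]] := orbit_repr_to_orbit x.
rewrite /alpha -s_a -t_a /= /atgt.
by rewrite (@arep_preserving _ _ _ _ _ a) //; exact: arep_dom.
Qed.

Lemma alpha_surj (q : Q) : exists A, alpha A = q.
Proof.
have [A [_ _ _] E] := os_class (ob_structure Q).
have [[_ cov _] _] := (E _).1 (rp_atlas V).
have [_ [i <-] [x <-]] := cov q.
by exists (@to_orbit _ _ _ atlas_groupoid (in_total x)); rewrite alphaE.
Qed.

(* The inverse of alpha, which is a bijection. *)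
Definition alpha_inv (q : Q) : orbit_space atlas_groupoid :=
  sval (cid (alpha_surj q)).

(* As a transition on the total space, a change of charts from some chart of V
   to some chart of V. *)
Definition atlas_change (f : transition total) : Prop :=
  exists (i j : rp_index V) (A : set (V i)) (h : V i -> V j),
    [/\ change_of_charts A h, tdom f = @in_total i @` A &
        forall x, A x -> f (in_total x) = in_total (h x)].

(* The domain of f underlies a restriction C of a chart of V, and f embeds C in
   a chart of V. *)
Definition atlas_embedding (f : transition total) : Prop :=
  exists (j k : rp_index V) (C : orb_chart Q n) (mu : C -> V j)
    (kappa : C -> V k),
    [/\ chart_of C, chart_restriction mu, chart_embedding kappa,
        tdom f = range (fun z => in_total (mu z)) &
        forall z, f (in_total (mu z)) = in_total (kappa z)].

End AtlasGroupoid.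

Arguments proj_total {v n Q} V x.
Arguments Psi {v n Q} V f.
Arguments alpha {v n Q} V A.
Arguments alpha_inv {v n Q} V q.


Definition quasi_pseudogroup n (M : smooth_space R n) (P : set (transition M)) :
    Prop :=
  (forall f x, P f -> tdom f x ->
    exists (g : transition M) (U W : set M),
      [/\ P g, open U /\ open W, U x /\ U `<=` tdom f,
          W (f x) /\ W `<=` tdom g &
          f @` U = W /\ forall y, U y -> g (f y) = y]) /\
  (forall f g x, P f -> P g -> tdom f x -> (tcod f `&` tdom g) (f x) ->
    exists (h : transition M) (U : set M),
      [/\ P h, open U, U x,
          U `<=` tdom f `&` f @^-1` (tcod f `&` tdom g) `&` tdom h &
          forall y, U y -> g (f y) = h y]).

Definition generates n (M : smooth_space R n) (P S : set (transition M)) :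
    Prop :=
  P `<=` S /\
  forall f x, S f -> tdom f x ->
    exists g, [/\ P g, tdom g x & \forall y \near x, f y = g y].

Definition local_lift (Q Q' : topologicalType) n n' (f : Q -> Q')
    (C : orb_chart Q n) (C' : orb_chart Q' n') (g : C -> C') : Prop :=
  smooth g /\ forall x, oc_map (g x) = f (oc_map x).

Section OrbifoldMaps.
Context (v : version) (n n' : nat) (Q : orbifold v n) (Q' : orbifold v n').
Context (V : representative Q) (V' : representative Q').

Definition lift_family :=
  forall i : rp_index V, {j : rp_index V' & V i -> V' j}.

Definition coprod_lift (F : lift_family) (x : total V) : total V' :=
  in_total (projT2 (F (projT1 x)) (projT2 x)).

Record orb_map_rep := OrbMapRep {
  om_map : Q -> Q';
  om_lift : lift_family;
  om_P : set (transition (total V));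
  om_nu : {l : transition (total V) | om_P l} -> transition (total V');
  om_continuous : continuous om_map;
  om_local_lift : forall i, local_lift om_map (projT2 (om_lift i));
  om_quasi : quasi_pseudogroup om_P;
  om_changes : forall l, om_P l -> atlas_change l;
  om_generates : generates om_P (Psi V);
  om_nu_Psi : forall l, Psi V' (om_nu l);
  om_nu_embedding : forall l, atlas_embedding (om_nu l);
  om_nu_psi : forall l x, tdom (sval l) x ->
    tdom (om_nu l) (coprod_lift om_lift x) /\
    coprod_lift om_lift (sval l x) = om_nu l (coprod_lift om_lift x);
  om_nu_germ : forall l m x, tdom (sval l) x -> tdom (sval m) x ->
    germ x (sval l) = germ x (sval m) ->
    germ (coprod_lift om_lift x) (om_nu l) =
    germ (coprod_lift om_lift x) (om_nu m);
  om_nu_comp : forall l m h x,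
    tdom (sval l) x -> tdom (sval m) (sval l x) -> tdom (sval h) x ->
    (\forall y \near x, sval h y = sval m (sval l y)) ->
    germ (coprod_lift om_lift x) (tcomp (om_nu m) (om_nu l)) =
    germ (coprod_lift om_lift x) (om_nu h);
  om_nu_id : forall l x, tdom (sval l) x ->
    (\forall y \near x, sval l y = y) ->
    germ (coprod_lift om_lift x) (om_nu l) =
    germ (coprod_lift om_lift x) (tid (total V')) }.

Definition om_psi (r : orb_map_rep) : total V -> total V' :=
  coprod_lift (om_lift r).

Definition om_equiv (r s : orb_map_rep) : Prop :=
  [/\ om_map r = om_map s, forall i, om_lift r i = om_lift s i &
      forall (l : {l | om_P r l}) (m : {m | om_P s m}) x,
        tdom (sval l) x -> tdom (sval m) x ->
        germ x (sval l) = germ x (sval m) ->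
        germ (om_psi r x) (om_nu l) = germ (om_psi r x) (om_nu m)].

Definition Orb := {c : set orb_map_rep | exists r, c = om_equiv r}.

Definition om_class (r : orb_map_rep) : Orb :=
  exist _ (om_equiv r : set orb_map_rep) (ex_intro _ r erefl).

Definition Hom_atlas := groupoid_hom (atlas_groupoid V) (atlas_groupoid V').

(* phi_1 (germ_x l) = germ_{phi_0 x} (nu l) for all l in P and x in dom l. *)
Definition hom_on_germs (r : orb_map_rep) (phi : Hom_atlas) : Prop :=
  forall (l : {l | om_P r l}) x, tdom (sval l) x ->
    harr phi (mk_germ (proj_total V) x (sval l)) =
    mk_germ (proj_total V') (hobj phi x) (om_nu l).

End OrbifoldMaps.

End Orbifolds.

Arguments proj_total {R v n Q} V x.
Arguments Psi {R v n Q} V f.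
Arguments alpha {R v n Q} V A.
Arguments alpha_inv {R v n Q} V q.
Arguments Orb {R v n n' Q Q'} V V'.
Arguments Hom_atlas {R v n n' Q Q'} V V'.

(* Main.v *)
Require Import Defs.
From mathcomp Require Import all_boot all_order all_algebra.
From mathcomp Require Import finmap all_classical all_reals all_analysis.

(* A representative (f, {f_i}, P, nu) determines a functor, because every germ
   in Gamma(V) is the germ of an element of P and the conditions on nu say that
   germ_x l |-> germ_{psi(x)} nu(l) is well defined and functorial; it is
   smooth since near germ_x l it is psi read in the etale charts. Two
   representatives are equivalent iff they determine the same functor.
   Conversely, given a functor phi, let P consist of the changes of charts l of
   V for which phi_1 (germ_x l) = germ_{phi_0(x)} nu on all of dom l, for one
   nu in Psi(V') that is an embedding of a restricted chart, and choose nu(l)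
   among these. Everything reduces to the fact that each f in Psi(V) restricts,
   near each point x of its domain, to an element of P: phi_1 (germ_x f) is the
   germ of some g, which may be shrunk to a chart on a small neighborhood S of
   phi_0(x) that is stable under the isotropy group of phi_0(x), and by
   continuity of phi_1 the germs of f near x are sent to germs of the shrunk
   g. For S one takes the union of the translates of a small ball under the
   isotropy group; it is paracompact, being homeomorphic to an open subset of
   R^n, and adding it to V' yields an equivalent atlas. *)

Set Implicit Arguments.
Unset Strict Implicit.
Unset Printing Implicit Defensive.

Import Order.TTheory GRing.Theory Num.Theory.
Import numFieldNormedType.Exports.

Local Open Scope classical_set_scope.
Local Open Scope ring_scope.

Local Notation orbmap D := (@oc_map _ _ _ D).
Local Notation orbgroup D := (@oc_group _ _ _ D).
(* MathComp's [total] shadows the total space of a representative. *)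
Local Notation total := Defs.total.

(** * Topology *)

Section Topology.

Lemma near_open (T : topologicalType) (A : set T) x :
  open A -> A x -> nbhs x A.
Proof. by move=> oA Ax; apply: open_nbhs_nbhs. Qed.

Lemma open_preimage_on (T U : topologicalType) (f : T -> U) (A : set T)
    (B : set U) : open A -> open B ->
  (forall x, A x -> {for x, continuous f}) -> open (A `&` f @^-1` B).
Proof.
move=> oA oB fc; rewrite openE => x [Ax Bx]; apply: filterI.
  exact: near_open.
by apply: (fc x Ax); exact: near_open.
Qed.

Lemma connected_image_on (T U : topologicalType) (f : T -> U) (A : set T) :
  connected A -> (forall x, A x -> {for x, continuous f}) ->
  connected (f @` A).
Proof.
move=> cA fc; apply: connected_continuous_connected => //.
by apply: continuous_in_subspaceT => x /set_mem; exact: fc.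
Qed.

(** A clopen subset of the subspace is pushed forward by [set_val] to a relatively clopen subset of
    [A] in [T], to which the connectedness of [A] applies. *)
Lemma connected_set_type (T : topologicalType) (A : set T) :
  connected A -> connected [set: A].
Proof.
move=> cA B [b Bb] [_ [P oP <-] BO] [C].
have AE (D : set T) (E : set A) : E = set_val @^-1` D ->
    set_val @` E = A `&` D.
  move=> ->; apply/seteqP; split=> [_ [x Dx <-]|x [Ax Dx]].
    by split=> //; exact: set_valP.
  by exists (exist _ x (mem_set Ax)).
rewrite closedE setTI => cC BC; rewrite setTI in BO.
have oC : open (~` C) by rewrite openC closedE.
have [D oD DC] := oC.
have E : set_val @` B = A.
  apply: cA.
  - by exists (set_val b), b.
  - by exists P => //; exact: AE.
  - exists (~` D); first by rewrite closedC.
    by apply: AE; rewrite BC -[C]setCK -DC -preimage_setC.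
apply/seteqP; split=> // x _.
have : (set_val @` B) (set_val x).
  by apply: (eq_ind A (fun D : set T => D (set_val x)) _ _ (esym E)); exact: set_valP.
by move=> [y By /val_inj <-].
Qed.

(* The compactness of the [K k] is that of the ambient space, where the covering
   characterisation is available. *)
Lemma exhaustion_paracompact (T : ptopologicalType) (U : set T)
    (K : nat -> set T) :
  (forall k, compact (K k)) -> (forall k, closed (K k)) ->
  (forall k, K k `<=` (K k.+1)^°) -> (forall x, U x <-> exists k, K k x) ->
  K 0%N = set0 -> paracompact U.
Proof.
move=> cK clK sK UE K0 C Co Ccov.
have KS k : K k `<=` K k.+1 by move=> x /sK /interior_subset.
have Kle j k : (j <= k)%N -> K j `<=` K k.
  move=> /subnK <-; elim: (k - j)%N => // m IH.
  by rewrite addSn; exact: (subset_trans IH).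
(* [L] is a shell of the exhaustion, compact, and [W] an open shell around it
   that meets only finitely many of the others. *)
pose L k := K k.+1 `\` (K k)^°.
pose W k := (K k.+2)^° `\` K k.-1.
have oW k : open (W k).
  by apply: openI; [exact: open_interior|rewrite openC].
have cL k : compact (L k).
  apply: (subclosed_compact _ (cK k.+1)); last by move=> x [].
  apply: closedI => //; apply: open_closedC; exact: open_interior.
(* By compactness, [L k] is covered by finitely many ambient open sets whose traces on [U] belong to
   [C]. *)
have fF k : exists F : set (set T), [/\ finite_set F,
    F `<=` [set A | open A /\ C (set_val @^-1` A)] &
    L k `<=` \bigcup_(A in F) A].
  have : cover_compact (L k) by rewrite -compact_cover.
  move=> /(_ (set T) [set A | open A /\ C (set_val @^-1` A)] id).
  case=> [A []//|x Lx|].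
    have Ux : U x by apply/UE; exists k.+1; case: Lx.
    have : [set: U] (exist _ x (mem_set Ux)) by [].
    rewrite -Ccov => -[B CB Bx]; have [A oA AE] := Co B CB.
    by exists A; [split=> //; rewrite AE|rewrite -AE in Bx].
  move=> D DC LD; exists [set` D]; split; [exact: finite_fset| |exact: LD].
  by move=> A /= AD; have := DC A AD; rewrite in_setE.
have [F HF] := choice fF.
(* The refinement: the sets chosen for the shell [L k], cut down to [W k], which contains [L k]. *)
exists [set B | exists k A, F k A /\ B = set_val @^-1` (A `&` W k)]; split.
- move=> _ [k [A [FA ->]]]; exists (A `&` W k) => //; apply: openI => //.
  by have [_ FC _] := HF k; case: (FC A FA).
- apply/seteqP; split=> // x _.
  have Ux : exists k, K k (set_val x) by apply/UE; exact: set_valP.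
  (* The least [k] with [x] in [K k] is positive because [K 0] is empty, so [x] lies in the shell
     [L] of index [k - 1]. *)
  have [k Kx kmin] := ex_minnP (P := fun k => `[< K k (set_val x) >])
    (let: ex_intro k Kx := Ux in ex_intro _ k (asboolT Kx)).
  move/asboolP : Kx => Kx.
  case: k => [|k] in Kx kmin *; first by rewrite K0 in Kx.
  have nKx : ~ K k (set_val x) by move=> /asboolP /kmin; rewrite ltnn.
  have Lx : L k (set_val x) by split=> // /interior_subset.
  have [_ _ /(_ _ Lx) [A FA Ax]] := HF k.
  exists (set_val @^-1` (A `&` W k)); first by exists k, A.
  split=> //; split; first exact: sK.
  by move=> Kx'; apply: nKx; exact: (Kle _ _ (leq_pred k)).
- move=> _ [k [A [FA ->]]]; exists (set_val @^-1` A); last by move=> x [].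
  by have [_ FC _] := HF k; case: (FC A FA).
- move=> x; have [m Kx] : exists k, K k (set_val x) by apply/UE; exact: set_valP.
  (* For [k >= m + 3] the set [K k.-1], which [W k] avoids, contains [K m.+1]; so only smaller
     indices contribute near [x]. *)
  exists (set_val @^-1` (K m.+1)^°).
    apply: open_nbhs_nbhs; split; last exact: sK.
    by exists (K m.+1)^° => //; exact: open_interior.
  apply: (@sub_finite_set _ _
      (\bigcup_(k in `I_m.+3) ((fun A => set_val @^-1` (A `&` W k)) @` F k))).
    move=> _ [[k [A [FA ->]]] [y [[_ [_ nK]] /interior_subset Ky]]].
    exists k; last by exists A.
    rewrite /= ltnNge; apply/negP => mk; apply: nK; apply: Kle Ky.
    by case: k mk {FA} => // k mk /=; exact: ltnW.
  apply: bigcup_finite; first exact: finite_II.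
  by move=> k _; apply: finite_image; have [] := HF k.
Qed.

End Topology.

(** * Connected balls and paracompact open subsets of R^n *)

Section Euclidean.
Context (R : realType).

(** The ball is the union of the segments from its center to its points, each a continuous image of
    [0, 1], and all contain the center. *)
Lemma connected_ball (W : normedModType R) (x : W) (r : R) : 0 < r ->
  connected (ball x r).
Proof.
move=> r0.
pose seg (y : W) (t : R) := x + t *: (y - x).
have -> : ball x r = \bigcup_(y in ball x r) (seg y @` `[0, 1]%classic).
  apply/seteqP; split=> [y xy|z [y xy [t]]].
    exists y => //; exists 1; first by rewrite /= in_itv /= ler01 lexx.
    by rewrite /seg scale1r addrC subrK.
  rewrite /= in_itv /= => /andP[t0 t1] <-.
  move: xy; rewrite -!ball_normE /= /seg opprD addrA subrr sub0r normrN normrZ.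
  rewrite distrC; apply: le_lt_trans.
  by rewrite ger0_norm // ler_piMl.
apply: bigcup_connected.
  exists x => y _; exists 0; first by rewrite /= in_itv /= lexx ler01.
  by rewrite /seg scale0r addr0.
move=> y _; apply: connected_image_on; first exact: segment_connected.
move=> t _; apply: continuousD; first exact: cst_continuous.
exact: scalel_continuous.
Qed.

Lemma paracompact_open n (U : set 'rV[R]_n) : open U -> paracompact U.
Proof.
move=> oU.
(* The points of norm at most [k - 1] whose distance to the complement of [U] is at least
   [1 / (k + 1)]. The shift by 1 in the norm makes [K 0] empty. *)
pose K (k : nat) := [set a : 'rV[R]_n | `|a| + 1 <= k%:R] `&`
  \bigcap_(b in ~` U) [set a | k.+1%:R^-1 <= `|a - b|].
have clK k : closed (K k).
  apply: closedI.
    rewrite (_ : mkset _ = Num.norm @^-1` [set t : R | t <= k%:R - 1]).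
      apply: closed_comp; last exact: closed_le.
      by move=> a _; exact: norm_continuous.
    by apply/seteqP; split=> a /=; rewrite lerBrDr.
  apply: closed_bigI => b _.
  apply: (@closed_comp _ _ (fun a : 'rV[R]_n => `|a - b|)
    [set t : R | k.+1%:R^-1 <= t]); last exact: closed_ge.
  move=> a _; apply: continuous_comp; last exact: norm_continuous.
  by apply: continuousB; [exact: cvg_id|exact: cst_continuous].
apply: (@exhaustion_paracompact _ U K) => //.
- move=> k; apply: bounded_closed_compact => //.
  exists k%:R; split=> // M kM a [/= ak _]; apply: ltW; apply: le_lt_trans kM.
  by apply: le_trans ak; rewrite lerDl.
- move=> k a [/= ak aU].
  (* From [K k] to [K k.+1] the norm bound relaxes by 1 and the distance bound by this difference;
     the smaller of the two is the radius of a ball inside [K k.+1]. *)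
  have e0 : 0 < k.+1%:R^-1 - k.+2%:R^-1 :> R.
    by rewrite subr_gt0 ltf_pV2 ?posrE // ltr_nat.
  rewrite /interior -nbhs_ballE.
  exists (Num.min 1 (k.+1%:R^-1 - k.+2%:R^-1)).
    by rewrite /= lt_min ltr01 e0.
  move=> c; rewrite -ball_normE /= lt_min => /andP[ac1 ace]; split=> /=.
    rewrite -[k.+1]addn1 natrD lerD2r; apply: le_trans ak.
    rewrite -[c](subrK a); apply: le_trans (ler_normD _ _) _.
    by rewrite addrC lerD2l distrC ltW.
  move=> b Ub; have /= := aU b Ub.
  rewrite -[a - b](subrKA c) => h.
  have := le_trans h (ler_normD _ _); rewrite -lerBlDl; apply: le_trans.
  by rewrite lerBrDl -lerBrDr ltW.
- move=> a; split=> [Ua|[k [_ aU]]]; last first.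
    apply: contrapT => /aU /=; rewrite subrr normr0 => h.
    have := lt_le_trans (_ : 0 < k.+1%:R^-1 :> R) h.
    by rewrite ltxx invr_gt0 ltr0Sn => /(_ isT).
  have : nbhs a U by exact: near_open.
  rewrite -nbhs_ballE => -[e /= e0 aeU].
  (* [k1.+1] exceeds the norm plus 1, and [1 / (k2 + 1)] is less than the radius [e] of a ball
     around [a] in [U]. *)
  pose k1 := Num.truncn (`|a| + 1); pose k2 := Num.truncn e^-1.
  exists (maxn k1.+1 k2); split=> /=.
    apply: ltW; apply: lt_le_trans (truncnS_gt _) _.
    by rewrite ler_nat leq_maxl.
  move=> b Ub /=; rewrite leNgt; apply/negP => h; apply: Ub; apply: aeU.
  rewrite -ball_normE /=; apply: lt_trans h _.
  rewrite invf_plt ?posrE //; apply: lt_le_trans (truncnS_gt _) _.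
  by rewrite ler_nat ltnS leq_maxr.
- apply/seteqP; split=> // a [/= + _]; rewrite leNgt => /negP; apply.
  by rewrite ltr_wpDl.
Qed.

Lemma hausdorff_set_type (T : topologicalType) (A : set T) :
  hausdorff_space T -> hausdorff_space A.
Proof.
move=> hT x y xy; apply: val_inj; apply: hT => B D Bx Dy.
have cv (z : A) : set_val @ z --> set_val z by exact: (@initial_continuous A T set_val).
by have [z [Bz Dz]] := xy _ _ (cv x B Bx) (cv y D Dy); exists (set_val z).
Qed.

End Euclidean.

(** * Diffeomorphisms *)

Section Diffeos.
Context (R : realType).

(** The image of a small coordinate ball serves as [B]. *)
Lemma smooth_locally_connected n (M : smooth_space R n) (A : set M) (x : M) :
  open A -> A x -> exists B, [/\ open B, connected B, B x & B `<=` A].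
Proof.
move=> oA Ax; have [c [_ [a [ca cax]]]] := ss_cover x.
have oD : open (lp_dom c `&` c @^-1` A).
  apply: open_preimage_on => //; [exact: lp_dom_open|exact: lp_continuous].
have : nbhs a (lp_dom c `&` c @^-1` A).
  by apply: near_open => //; split=> //; rewrite /preimage /= cax.
rewrite -nbhs_ballE => -[e /= e0 aeA].
exists (c @` ball a e); split.
- by apply: lp_open; [exact: ball_open|move=> b /aeA []].
- apply: connected_image_on; first exact: connected_ball.
  by move=> b /aeA [cb _]; exact: lp_continuous.
- by exists a => //; exact: ballxx.
- by move=> _ [b /aeA [_ ?] <-].
Qed.

Section Diffeo.
Context (n : nat) (M N : smooth_space R n).
Implicit Types (A B : set M) (f g : M -> N).

Lemma diffeo_open A f : is_diffeo_on A f -> open A. Proof. by case. Qed.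

Lemma diffeo_smooth A f x : is_diffeo_on A f -> A x -> smooth_at f x.
Proof. by case=> _ _ + _; apply. Qed.

Lemma diffeo_continuous A f x :
  is_diffeo_on A f -> A x -> {for x, continuous f}.
Proof. by move=> df Ax; exact/smooth_at_continuous/(diffeo_smooth df). Qed.

Lemma diffeo_image_open A B f :
  is_diffeo_on A f -> open B -> B `<=` A -> open (f @` B).
Proof.
move=> [oA ofA sf [k [kK sk]]] oB BA.
rewrite (_ : f @` B = f @` A `&` k @^-1` B).
  apply: open_preimage_on => // y fAy; exact/smooth_at_continuous/sk.
apply/seteqP; split=> [_ [x Bx <-]|_ [[x Ax <-]]].
  by split; [exists x => //; exact: BA|rewrite /preimage /= kK //; exact: BA].
by rewrite /preimage /= kK // => Bx; exists x.
Qed.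

Lemma diffeo_sub A B f :
  is_diffeo_on A f -> open B -> B `<=` A -> is_diffeo_on B f.
Proof.
move=> df oB BA; have ofB := diffeo_image_open df oB BA.
have [oA ofA sf [k [kK sk]]] := df; split=> //; first by move=> x /BA; exact: sf.
exists k; split=> [x /BA /kK//|_ [x Bx <-]].
by apply: sk; exists x => //; exact: BA.
Qed.

(** Lets a map be altered off [A], as is needed to turn it into a transition or to factor it through
    a summand. *)
Lemma diffeo_eq A f g :
  is_diffeo_on A f -> (forall x, A x -> f x = g x) -> is_diffeo_on A g.
Proof.
move=> [oA ofA sf [k [kK sk]]] fg.
have E : g @` A = f @` A.
  by apply/seteqP; split=> _ [x Ax <-]; exists x => //; rewrite fg.
split=> //; rewrite ?E //; last by exists k; split=> // x Ax; rewrite -fg ?kK.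
move=> x Ax; apply: smooth_at_near (sf x Ax).
near=> y; apply: fg; near: y; exact: near_open.
Unshelve. all: by end_near. Qed.

Lemma diffeo_inv A f (k : N -> M) : is_diffeo_on A f ->
  (forall x, A x -> k (f x) = x) -> is_diffeo_on (f @` A) k.
Proof.
move=> [oA ofA sf [h [hK sh]]] kK.
have E : k @` (f @` A) = A.
  apply/seteqP; split=> [_ [_ [x Ax <-] <-]|x Ax]; first by rewrite kK.
  by exists (f x); [exists x|exact: kK].
split=> //; first by rewrite E.
  move=> y fAy; apply: smooth_at_near (sh y fAy).
  near=> z.
  have [x Ax <-] : (f @` A) z by near: z; exact: near_open.
  by rewrite hK // kK.
by exists f; rewrite E; split=> // _ [x Ax <-]; rewrite kK.
Unshelve. all: by end_near. Qed.

End Diffeo.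

Lemma diffeo_comp n (M N K : smooth_space R n) (A : set M) (B : set N)
    (f : M -> N) (g : N -> K) : is_diffeo_on A f -> is_diffeo_on B g ->
  f @` A `<=` B -> is_diffeo_on A (g \o f).
Proof.
move=> df dg AB; have AB' x : A x -> B (f x) by move=> Ax; apply: AB; exists x.
have [oA ofA sf [k [kK sk]]] := df; have [oB ogB sg [h [hK sh]]] := dg.
split=> //.
- by rewrite -image_comp; exact: diffeo_image_open dg _ _.
- move=> x Ax; apply: smooth_at_comp; [exact: sf|exact/sg/AB'].
- exists (k \o h); split=> [x Ax|_ [x Ax <-]] /=.
    by rewrite hK ?kK //; exact: AB'.
  apply: smooth_at_comp; first by apply: sh; exists (f x) => //; exact: AB'.
  by rewrite hK; [apply: sk; exists x|exact: AB'].
Qed.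

(** Provides the connected domain and image that a change of charts must have. *)
Lemma diffeo_change n (M N : smooth_space R n) (A : set M) (f : M -> N) x
    (B : set N) : is_diffeo_on A f -> A x -> open B -> B (f x) ->
  exists A', [/\ is_diffeo_on A' f, connected A', connected (f @` A'), A' x &
     A' `<=` A `&` f @^-1` B].
Proof.
move=> df Ax oB Bx.
have oAB : open (A `&` f @^-1` B).
  apply: open_preimage_on => //; first exact: diffeo_open df.
  by move=> z Az; exact: diffeo_continuous df Az.
have [A' [oA' cA' A'x sA']] := smooth_locally_connected oAB (conj Ax Bx).
have sA x' : A' x' -> A x' by case/sA'.
exists A'; split=> //; first exact: diffeo_sub df _ _.
by apply: connected_image_on => // z /sA; exact: diffeo_continuous df.
Qed.

Lemma smooth_diffeo n (M : smooth_space R n) (f g : M -> M) :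
  smooth f -> smooth g -> cancel f g -> cancel g f -> is_diffeo_on setT f.
Proof.
move=> sf sg fK gK; have E : f @` setT = setT.
  by apply/seteqP; split=> // x _; exists (g x).
split; rewrite ?E; [exact: openT|exact: openT|by move=> x _; exact: sf|].
by exists g; split=> [x _|x _]; [exact: fK|exact: sg].
Qed.

(** * Summands of a coproduct as open subsets *)

Section CoprodDiffeo.
Context (n : nat) (I : choiceType) (X : I -> smooth_space R n) (i : I).

Lemma open_coprod_in (A : set (X i)) : open A -> open (@coprod_in R n I X i @` A).
Proof. exact: existT_open_map. Qed.

Lemma coprod_in_smooth : smooth (@coprod_in R n I X i : X i -> coprod X).
Proof.
move=> x c d Hc [j [d0 [Hd ->]]] a b ca /= db cax dbx.
have ji : j = i by exact: (congr1 (@projT1 _ _) dbx).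
subst j; have {}dbx := coprod_in_inj dbx.
have [g [sg gab Eg]] := ss_compat Hc Hd ca db (etrans cax (esym dbx)).
by exists g; split=> //; apply: filterS Eg => a' ->.
Qed.

(* The default [x0] is only used outside the summand [i]. *)
Definition coprod_out (x0 : X i) (y : coprod X) : X i :=
  match pselect (projT1 y = i) with
  | left e => ecast j (X j) e (projT2 y)
  | right _ => x0
  end.

Lemma coprod_inK x0 : cancel (@coprod_in R n I X i) (coprod_out x0).
Proof.
move=> x; rewrite /coprod_out; case: pselect => // e.
by rewrite (eq_irrelevance e erefl).
Qed.

Lemma coprod_outK x0 (y : coprod X) : projT1 y = i ->
  coprod_in (coprod_out x0 y) = y.
Proof. by case: y => j y /= ji; subst j; rewrite coprod_inK. Qed.

Lemma coprod_in_range (y : coprod X) :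
  range (@coprod_in R n I X i) y <-> projT1 y = i.
Proof.
split=> [[x _ <-]//|]; case: y => j y /= ji; subst j; by exists y.
Qed.

Lemma coprod_in_diffeo (x0 : X i) :
  is_diffeo_on setT (@coprod_in R n I X i : X i -> coprod X).
Proof.
split; [exact: openT|exact/open_coprod_in/openT|by move=> x _; exact: coprod_in_smooth|].
exists (coprod_out x0); split; first by move=> x _; exact: coprod_inK.
move=> _ [x _ <-] c d [j [c0 [Hc ->]]] Hd a b /= ca db cax.
have ji : j = i by exact: (congr1 (@projT1 _ _) cax).
subst j; have {}cax := coprod_in_inj cax; rewrite coprod_inK => dbx.
have [g [sg gab Eg]] := ss_compat Hc Hd ca db (etrans cax (esym dbx)).
by exists g; split=> //; apply: filterS Eg => a' <-; rewrite coprod_inK.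
Qed.

End CoprodDiffeo.
End Diffeos.

(** * Restrictions of orbifold charts *)

Lemma filter_finite_bigI (T : Type) (F : set_system T) {FF : Filter F}
    (I : choiceType) (D : set I) (f : I -> set T) :
  finite_set D -> (forall i, D i -> F (f i)) -> F (\bigcap_(i in D) f i).
Proof.
move=> /finite_fsetP [X ->] H; apply: filter_bigI => i iX; exact: H.
Qed.

(** * Continuity and openness of the projection of a chart *)

Section OrbitMap.
Context (R : realType) (Q : topologicalType) (n : nat) (D : orb_chart R Q n).

Lemma group_continuous g : oc_group g -> continuous (g : D -> D).
Proof. by move=> /oc_smooth sg x; exact: smooth_at_continuous. Qed.

Lemma oc_mapG g (x : D) : oc_group g -> oc_map (g x) = oc_map x.
Proof. by move=> Gg; apply/esym/oc_orbit; exists g. Qed.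

Lemma group_diffeo g : oc_group g -> is_diffeo_on setT (g : D -> D).
Proof.
move=> Gg; have [h [Gh gK hK]] := oc_inv Gg.
by apply: (smooth_diffeo _ _ gK hK); exact: oc_smooth.
Qed.

(** [oc_homeo] concerns subsets of the image only, so [A] is first intersected with that open
    image. *)
Lemma oc_map_continuous : continuous (orbmap D).
Proof.
apply/continuousP => A oA.
have -> : orbmap D @^-1` A = orbmap D @^-1` (A `&` range (orbmap D)).
  by apply/seteqP; split=> [x Ax|x []//]; split=> //; exists x.
have sA : A `&` range (orbmap D) `<=` range (orbmap D) by move=> ? /= [].
apply/(oc_homeo sA).
by apply: openI => //; exact: oc_open.
Qed.

(** The saturation of [A] is the union of its preimages under the group elements, hence open, and
    [oc_homeo] brings this down to [Q]. *)
Lemma oc_map_open (A : set D) : open A -> open (orbmap D @` A).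
Proof.
move=> oA; have sA : orbmap D @` A `<=` range (orbmap D) by move=> _ [x _ <-]; exists x.
apply/(oc_homeo sA).
rewrite (_ : _ @^-1` _ = \bigcup_(g in orbgroup D) (g @^-1` A)).
  apply: bigcup_open => g Gg; apply: open_comp => // x _; exact: group_continuous.
apply/seteqP; split=> [x [y Ay /esym /oc_orbit [g Gg E]]|x [g Gg Ax]].
  by exists g => //; rewrite /preimage /= E.
by exists (g x) => //; exact: oc_mapG.
Qed.

End OrbitMap.

(** * The restricted chart on a stable open subset *)

Section Restriction.
Context (R : realType) (Q : topologicalType) (n : nat) (D : orb_chart R Q n).
Context (M : manifold R n) (mu : M -> D).
Hypothesis connM : connected [set: M].
Hypothesis M0 : [set: M] !=set0.
Hypothesis dmu : is_diffeo_on setT mu.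
(** Ensures that two points of the range in one orbit are related by a group element acting on the
    whole range, so that the fibers of the restricted chart are orbits of [restr_group]. *)
Hypothesis stab : forall g x, oc_group g -> range mu x -> range mu (g x) ->
  forall y, range mu y -> range mu (g y).

Let k : D -> M := sval (cid (let: And4 _ _ _ k := dmu in k)).

Let kK : cancel mu k.
Proof. by move=> x; rewrite /k; case: cid => /= h [hK _]; exact: hK. Qed.

Let muK y : range mu y -> mu (k y) = y.
Proof. by move=> [x _ <-]; rewrite kK. Qed.

Let sk y : range mu y -> smooth_at k y.
Proof. by move=> Sy; rewrite /k; case: cid => /= h [_ sh]; exact: sh. Qed.

Definition restr_group : set (M -> M) :=
  [set h | exists2 g : D -> D, oc_group g & forall u, mu (h u) = g (mu u)].

(** An element [h] is recovered from an inducing [g] as [k \o g \o mu], so the finite group of [D]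
    surjects onto a set containing [restr_group]. *)
Lemma restr_finite : finite_set restr_group.
Proof.
apply: (@sub_finite_set _ _ ((fun g => k \o g \o mu) @` orbgroup D)).
  move=> h [g Gg hg]; exists g => //; apply/funext => u /=.
  by rewrite -hg kK.
apply: finite_image; exact: oc_finite.
Qed.

Lemma restr_smooth h : restr_group h -> smooth h.
Proof.
move=> [g Gg hg] u.
have -> : h = k \o (g \o mu) by apply/funext => w /=; rewrite -hg kK.
apply: smooth_at_comp; last by apply: sk; rewrite /= -hg; exists (h u).
apply: smooth_at_comp; last exact: oc_smooth.
exact: (diffeo_smooth dmu).
Qed.

Lemma restr_id : restr_group id.
Proof. by exists id => //; exact: oc_id. Qed.

Lemma restr_comp h1 h2 :
  restr_group h1 -> restr_group h2 -> restr_group (h1 \o h2).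
Proof.
move=> [g1 G1 E1] [g2 G2 E2]; exists (g1 \o g2); first exact: oc_comp.
by move=> u; rewrite /= E1 E2.
Qed.

(** By [stab], testing [g] at a single point is enough to make it act on all of [M]. *)
Lemma restr_of g u : oc_group g -> range mu (g (mu u)) ->
  restr_group (k \o g \o mu) /\ mu ((k \o g \o mu) u) = g (mu u).
Proof.
move=> Gg Sgu; split; last exact: muK.
exists g => // w; apply: muK; apply: (stab Gg _ Sgu); [by exists u|by exists w].
Qed.

Lemma restr_inv h : restr_group h ->
  exists h', [/\ restr_group h', cancel h h' & cancel h' h].
Proof.
move=> [g Gg hg]; have [g' [Gg' gK g'K]] := oc_inv Gg.
have [u0 _] := M0.
(* The inverse [g'] takes [mu (h u0)] back to [mu u0]; this is the one point at which it has to be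
   tested. *)
have [|Gh' _] := @restr_of g' (h u0) Gg'; first by rewrite hg gK; exists u0.
have E u : mu ((k \o g' \o mu) u) = g' (mu u).
  apply: muK; apply: (stab Gg' (x := g (mu u0))); last by exists u.
    by rewrite -hg; exists (h u0).
  by rewrite gK; exists u0.
exists (k \o g' \o mu); split=> // u; first by rewrite /= hg gK kK.
by apply: (can_inj kK); rewrite hg E g'K.
Qed.

Lemma restr_open : open (range (orbmap D \o mu)).
Proof.
by rewrite -(image_comp mu (orbmap D)); apply: oc_map_open; case: dmu.
Qed.

Lemma restr_orbit u w : (orbmap D \o mu) u = (orbmap D \o mu) w <->
  exists2 h, restr_group h & h u = w.
Proof.
split=> [/= /oc_orbit [g Gg guw]|[h [g Gg hg] <- /=]].
  have [|Gh E] := @restr_of g u Gg; first by rewrite guw; exists w.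
  exists (k \o g \o mu) => //; apply: (can_inj kK).
  by rewrite E.
by rewrite hg oc_mapG.
Qed.

Lemma restr_homeo (A : set Q) : A `<=` range (orbmap D \o mu) ->
  (open A <-> open ((orbmap D \o mu) @^-1` A)).
Proof.
move=> sA; split=> [oA|oA].
  apply: open_comp => // u _; apply: continuous_comp; last exact: oc_map_continuous.
  exact: (diffeo_continuous dmu).
rewrite (_ : A = orbmap D @` (mu @` ((orbmap D \o mu) @^-1` A))).
  by apply: oc_map_open; exact: diffeo_image_open dmu oA _.
rewrite image_comp; apply/seteqP; split=> [q Aq|_ [u Au <-]]; last exact: Au.
by have [u _ uq] := sA q Aq; exists u => //; rewrite /preimage /mkset uq.
Qed.

Definition restr_chart : orb_chart R Q n :=
  OrbChart connM M0 restr_finite restr_smooth restr_id restr_comp restr_inv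
    restr_open restr_orbit restr_homeo.

Lemma restr_chartP : chart_restriction (mu : restr_chart -> D).
Proof.
split; [by split|by []|].
move=> g Gg gS; have [u0 _] := M0.
have Sg u : range mu (g (mu u)) by rewrite -gS; exists (mu u) => //; exists u.
exists (k \o g \o mu); first by have [] := restr_of Gg (Sg u0).
by move=> u; have [] := restr_of Gg (Sg u).
Qed.

End Restriction.

(** * Open subsets of a coordinate domain as manifolds *)

Section OpenSubmanifold.
Context (R : realType) (n : nat) (N : smooth_space R n) (c : local_param R N n).
Context (U : set 'rV[R]_n) (u0 : U).
Hypothesis Hc : ss_atlas c.
Hypothesis oU : open U.
Hypothesis Uc : U `<=` lp_dom c.

(** The inverse of [set_val] on [U]; the point [u0] is a default off [U]. *)
Definition to_sub (a : 'rV[R]_n) : U :=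
  match pselect (U a) with
  | left Ua => exist _ a (mem_set Ua)
  | right _ => u0
  end.

Lemma to_subK a : U a -> set_val (to_sub a) = a.
Proof. by rewrite /to_sub; case: pselect. Qed.

Lemma set_val_to_sub (u : U) : to_sub (set_val u) = u.
Proof. by apply: val_inj; apply: to_subK; exact: set_valP. Qed.

Lemma to_sub_continuous a : U a -> {for a, continuous to_sub}.
Proof.
move=> Ua W; rewrite nbhsE => -[_ [[A oA <-] Aa] sW].
have : nbhs a (A `&` U).
  apply: near_open; first exact: openI.
  by split=> //; move: Aa; rewrite /preimage /= to_subK.
by apply: filterS => b [Ab Ub]; apply: sW; rewrite /preimage /= to_subK.
Qed.

Lemma to_sub_inj a b : U a -> U b -> to_sub a = to_sub b -> a = b.
Proof. by move=> Ua Ub /(congr1 set_val); rewrite !to_subK. Qed.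

Lemma to_sub_open A : open A -> A `<=` U -> open (to_sub @` A).
Proof.
move=> oA AU; exists A => //; apply/seteqP; split=> [u Au|_ [a Aa <-]].
  by exists (set_val u) => //; exact: set_val_to_sub.
by rewrite /preimage /= to_subK //; exact: AU.
Qed.

Definition sub_param : local_param R U n :=
  LocalParam oU to_sub_continuous to_sub_inj to_sub_open.

Lemma sub_cover (u : U) : exists e, [set sub_param] e /\
  exists a, lp_dom e a /\ e a = u.
Proof.
exists sub_param; split=> //; exists (set_val u); split; first exact: set_valP.
exact: set_val_to_sub.
Qed.

Lemma sub_compat e d : [set sub_param] e -> [set sub_param] d ->
  forall a b, lp_dom e a -> lp_dom d b -> e a = d b ->
  exists g : 'rV[R]_n -> 'rV[R]_n,
    [/\ smooth_near a g, g a = b & \forall a' \near a, e a' = d (g a')].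
Proof.
move=> -> -> a b Ua Ub E; exists id; split; [exact: smooth_near_id| |].
  exact: to_sub_inj E.
by near=> a'.
Unshelve. all: by end_near. Qed.

Definition sub_space : smooth_space R n := SmoothSpace sub_cover sub_compat.

Lemma sub_hausdorff : hausdorff_space sub_space.
Proof. apply: hausdorff_set_type; exact: norm_hausdorff. Qed.

(** The underlying space is the coordinate set [U] and not its image in [N], so that the separation
    axiom and paracompactness come from R^n. *)
Definition sub_manifold : manifold R n :=
  Manifold sub_hausdorff (paracompact_open oU).

Definition sub_incl (u : sub_manifold) : N := c (set_val u).

Lemma sub_incl_range : range sub_incl = c @` U.
Proof.
apply/seteqP; split=> [_ [u _ <-]|_ [a Ua <-]].
  by exists (set_val u) => //; exact: set_valP.
by exists (to_sub a) => //; rewrite /sub_incl to_subK.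
Qed.

Lemma sub_incl_diffeo : is_diffeo_on setT sub_incl.
Proof.
split; [exact: openT| | |].
- by rewrite sub_incl_range; exact: lp_open.
- move=> u _ _ d -> Hd a b /= Ua db au dbu.
  have cadb : c a = d b by rewrite dbu -au /sub_incl to_subK.
  have [g [sg gab Eg]] := ss_compat Hc Hd (Uc Ua) db cadb.
  exists g; split=> //; near=> a'; rewrite /sub_incl to_subK; first by near: a'.
  by near: a'; exact: near_open.
- have kP : exists k : N -> sub_manifold, forall a, U a -> k (c a) = to_sub a.
    exists (fun x => match pselect (exists a, U a /\ c a = x) with
      | left H => to_sub (sval (cid H)) | right _ => u0 end) => a Ua.
    case: pselect => [H|[]]; last by exists a.
    case: (cid H) => b [Ub ba] /=; congr to_sub.
    by apply: lp_inj ba; exact: Uc.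
  have [k kK] := kP; exists k; split=> [u _|].
    rewrite /sub_incl kK; [exact: set_val_to_sub|exact: set_valP].
  rewrite sub_incl_range => _ [a0 Ua0 <-] d e Hd -> a b da /= Ub dax bE.
  rewrite kK // in bE; have ba0 := to_sub_inj Ub Ua0 bE.
  subst b.
  have [g [sg gab Eg]] := ss_compat Hd Hc da (Uc Ua0) dax.
  exists g; split=> //.
  have gc : g @ a --> g a by exact: smooth_near_continuous.
  have Ug : \forall a' \near a, U (g a').
    by apply: (gc U); rewrite gab; exact: near_open.
  by apply: filterS2 Eg Ug => a' -> Uga; rewrite kK.
Unshelve. all: by end_near. Qed.

End OpenSubmanifold.

(** The inverse of [c] is continuous on the image of [c] because [c] is open, and it maps [S] onto
    the set in question. *)
Lemma connected_param_preimage (R : realType) n (T : topologicalType)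
    (c : local_param R T n) (S : set T) :
  S `<=` c @` lp_dom c -> connected S -> open S ->
  connected (lp_dom c `&` c @^-1` S).
Proof.
move=> Sc cS oS.
have iP : exists i : T -> 'rV[R]_n, forall a, lp_dom c a -> i (c a) = a.
  exists (fun x => match pselect (exists a, lp_dom c a /\ c a = x) with
    | left H => sval (cid H) | right _ => 0 end) => a ca.
  case: pselect => [H|[]]; last by exists a.
  by case: (cid H) => b [cb ba] /=; exact: lp_inj ba.
have [i iK] := iP.
rewrite (_ : _ `&` _ = i @` S).
  apply: connected_image_on => // x Sx.
  have [a ca cax] := Sc x Sx; rewrite -cax => W; rewrite iK // => Wa.
  have : nbhs a (W `&` lp_dom c).
    by apply: filterI => //; apply: near_open => //; exact: lp_dom_open.
  rewrite nbhsE => -[V' [oV' V'a] sV'].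
  have : nbhs (c a) (c @` V').
    apply: near_open; last by exists a.
    by apply: lp_open => // b /sV' [].
  by apply: filterS => _ [b /sV' [Wb cb] <-]; rewrite /preimage /= iK.
apply/seteqP; split=> [a [ca Sa]|_ [x Sx <-]].
  by exists (c a) => //; exact: iK.
by have [a ca cax] := Sc x Sx; rewrite -cax iK //; split=> //; rewrite /preimage /= cax.
Qed.

(** * Small neighborhoods stable under the isotropy group *)

Section GoodNeighborhoods.
Context (R : realType) (Q : topologicalType) (n : nat) (D : orb_chart R Q n).

(** An element fixing [y] preserves [S] because [S] is a union of translates under the isotropy
    group. An element moving [y] sends no point of [S] into [S], since [S] is small enough to be
    disjoint from its image. *)
Lemma stable_neighborhood (y : D) (N : set D) : open N -> N y ->
  exists S : set D, [/\ open S, connected S, S y, S `<=` N &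
    forall g x, orbgroup D g -> S x -> S (g x) -> forall z, S z -> S (g z)].
Proof.
move=> oN Ny.
(* If [A] and [B] separate [y] from [g y], then [A] cut with the preimage of [B] is disjoint from
   its image under [g]. *)
have sep g : orbgroup D g -> g y <> y ->
    exists N', nbhs y N' /\ forall x, N' x -> ~ N' (g x).
  move=> Gg gy.
  have : exists A B, [/\ nbhs y A, nbhs (g y) B & forall x, A x -> ~ B x].
    apply: contrapT => h; apply: gy; apply/esym; apply: (@mf_hausdorff R n D).
    move=> A B Ay By; apply: contrapT => AB; apply: h; exists A, B; split=> //.
    by move=> x Ax Bx; apply: AB; exists x.
  move=> [A [B [Ay By AB]]]; exists (A `&` g @^-1` B); split.
    by apply: filterI => //; exact: (group_continuous Gg).
  by move=> x [Ax Bgx] [/AB].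
have /choice [sepN HsepN] : forall g : D -> D, exists N' : set D,
    orbgroup D g -> g y <> y -> nbhs y N' /\ forall x, N' x -> ~ N' (g x).
  move=> g.
  have [Gg|] := pselect (orbgroup D g); last by exists setT.
  have [|/(sep g Gg) [N' HN']] := pselect (g y = y); first by exists setT.
  by exists N'.
pose N1 := N `&` \bigcap_(g in [set g | orbgroup D g /\ g y <> y]) sepN g.
have N1y : nbhs y N1.
  apply: filterI; first exact: near_open.
  apply: filter_finite_bigI.
    by apply: sub_finite_set (oc_finite D) => g [].
  by move=> g [Gg gy]; have [] := HsepN g Gg gy.
(* Points of [N2] stay in [N1] under the isotropy group, so every translate of [B] used in [S] stays
   in [N1]. *)
pose N2 := \bigcap_(g in [set g | orbgroup D g /\ g y = y]) (g @^-1` N1).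
have N2y : nbhs y N2.
  apply: filter_finite_bigI.
    by apply: sub_finite_set (oc_finite D) => g [].
  by move=> g [Gg gy]; apply: (group_continuous Gg); rewrite gy.
have [B [oB cB By BN2]] :
    exists B, [/\ open B, connected B, B y & B `<=` N2].
  have [B [oB cB By sB]] := smooth_locally_connected (@open_interior _ N2) N2y.
  by exists B; split=> // z /sB /interior_subset.
pose Gy := [set g | orbgroup D g /\ g y = y].
pose S := \bigcup_(g in Gy) (g @` B).
have SN1 : S `<=` N1 by move=> _ [g Gyg [b /BN2 N2b <-]]; exact: N2b.
have stab g : Gy g -> forall z, S z -> S (g z).
  move=> [Gg gy] _ [h [Gh hy] [b Bb <-]]; exists (g \o h); last by exists b.
  by split; [exact: oc_comp|rewrite /= hy].
exists S; split.
- apply: bigcup_open => g [Gg _].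
  exact: diffeo_image_open (group_diffeo Gg) oB _.
- apply: bigcup_connected; first by exists y => g [_ gy]; exists y.
  move=> g [Gg _]; apply: connected_image_on => // x _; exact: group_continuous.
- by exists id; [split=> //; exact: oc_id|exists y].
- by move=> x /SN1 [].
- move=> g x Gg Sx Sgx; apply: stab; split=> //; apply: contrapT => gy.
  have [_ /(_ x)] := HsepN g Gg gy; apply.
    by have [_] := SN1 _ Sx; apply.
  by have [_] := SN1 _ Sgx; apply.
Qed.

(** A stable neighborhood inside one coordinate patch corresponds to an open set [U] of R^n, and the
    manifold on [U] carries the restricted chart. *)
Lemma restriction_exists (y : D) (N : set D) : open N -> N y ->
  exists (C : orb_chart R Q n) (mu : C -> D),
    [/\ chart_restriction mu, range mu y & range mu `<=` N].
Proof.
move=> oN Ny.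
have [c [Hc [a [ca cay]]]] := ss_cover y.
have odc : open (c @` lp_dom c) by apply: lp_open => //; exact: lp_dom_open.
have [||S [oS cS Sy SN stab]] := @stable_neighborhood y (N `&` c @` lp_dom c).
- exact: openI.
- by split=> //; exists a.
pose U := lp_dom c `&` c @^-1` S.
have oU : open U.
  by apply: open_preimage_on => //; [exact: lp_dom_open|exact: lp_continuous].
have Uc : U `<=` lp_dom c by move=> ? [].
have cU : connected U.
  by apply: connected_param_preimage => // x /SN [].
have Ua : U a by split=> //; rewrite /preimage /= cay.
pose u0 : U := exist _ a (mem_set Ua).
have SE : range (@sub_incl R n D c U u0 oU) = S.
  rewrite sub_incl_range //; apply/seteqP; split=> [_ [b [_ Sb] <-] //|x Sx].
  have [_ [b cb bx]] := SN x Sx.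
  by exists b => //; split=> //; rewrite /preimage /= bx.
have connM : connected [set: sub_manifold u0 oU] := connected_set_type cU.
have M0 : [set: sub_manifold u0 oU] !=set0 by exists u0.
have dmu := sub_incl_diffeo u0 Hc oU Uc.
have stab' : forall g x, oc_group g ->
    range (@sub_incl R n D c U u0 oU) x ->
    range (@sub_incl R n D c U u0 oU) (g x) ->
    forall z, range (@sub_incl R n D c U u0 oU) z ->
    range (@sub_incl R n D c U u0 oU) (g z).
  by rewrite SE.
exists (restr_chart connM M0 dmu stab'), (@sub_incl R n D c U u0 oU).
split; first exact: restr_chartP.
- by rewrite SE.
- by rewrite SE => x /SN [].
Qed.

End GoodNeighborhoods.

(** * Compatibility and restrictions of transitions *)

Section Compatibility.
Context (R : realType) (Q : topologicalType) (n : nat).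
Implicit Types C D E : orb_chart R Q n.

Lemma compatible_sym C D : compatible C D -> compatible D C.
Proof.
move=> CD y x /esym /CD [A [h [Ax hAy [A0 cA chA dh ph]]]].
have [oA _ _ [k [kK _]]] := dh.
have E : k @` (h @` A) = A.
  apply/seteqP; split=> [_ [_ [z Az <-] <-]|z Az]; first by rewrite kK.
  by exists (h z); [exists z|exact: kK].
exists (h @` A), k; split=> //; first by rewrite E.
split=> //; first by exists y.
- by rewrite E.
- exact: diffeo_inv dh kK.
- by move=> _ [z Az <-]; rewrite kK // ph.
Qed.

(** [compatible] puts [y] in the image of [h] without giving [h x = y]; composing with a group
    element that takes [h x] to [y] achieves this. *)
Lemma change_of_charts_at C D x (y : D) : compatible C D -> orbmap C x = orbmap D y ->
  exists (A : set C) (h : C -> D), [/\ A x, h x = y & change_of_charts A h].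
Proof.
move=> CD xy; have [A [h [Ax [z Az hz] [A0 cA chA dh ph]]]] := CD x y xy.
have [g Gg ghx] : exists2 g, orbgroup D g & g (h x) = y.
  by apply/oc_orbit; rewrite ph.
have dgh : is_diffeo_on A (g \o h) by exact: diffeo_comp dh (group_diffeo Gg) _.
exists A, (g \o h); split=> //; split=> //.
- by apply: connected_image_on => // w Aw; exact: diffeo_continuous dgh _.
- by move=> w Aw /=; rewrite oc_mapG // ph.
Qed.

Lemma compatible_embedding C D E (mu : C -> D) :
  chart_embedding mu -> compatible D E -> compatible C E.
Proof.
move=> [dmu pmu] DE x y xy.
have [|A [h [Ax hx [A0 cA chA dh ph]]]] := @change_of_charts_at D E (mu x) y DE.
  by rewrite pmu.
have oA : open (mu @^-1` A).
  apply: open_comp; last by case: dh.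
  by move=> z _; exact: diffeo_continuous dmu _.
have dhm : is_diffeo_on (mu @^-1` A) (h \o mu).
  apply: diffeo_comp (diffeo_sub dmu oA _) dh _ => //.
  by move=> _ [z Az <-].
have [B [dB cB chB Bx sB]] := diffeo_change dhm Ax openT I.
exists B, (h \o mu); split=> //; first by exists x.
split=> //; first by exists x.
by move=> z /sB [Az _] /=; rewrite ph // pmu.
Qed.

Lemma is_atlas_add v (A : orb_chart R Q n -> Prop) C D (mu : C -> D) :
  is_atlas v A -> A D -> chart_embedding mu -> is_atlas v (fun E => A E \/ E = C).
Proof.
move=> [cA covA ctA] AD emu.
have CE E : A E -> compatible C E.
  by move=> AE; apply: compatible_embedding emu _; exact: cA.
split.
- move=> E F [AE|->] [AF|->]; [exact: cA|exact/compatible_sym/CE|exact: CE|].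
  by apply: compatible_embedding emu _; apply/compatible_sym; exact: CE.
- by move=> q; have [E AE Eq] := covA q; exists E => //; left.
- move=> /ctA [e einj].
  (* The numbers of the old charts go up by one, which leaves 0 for [C] if it is new. *)
  exists (fun E => if pselect (A E) then (e E).+1 else 0%N) => E F AE AF.
  case: pselect => /= nE; case: pselect => /= nF //.
    by case; exact: einj.
  by case: AE AF => [//|->] [//|->].
Qed.

End Compatibility.

(** * Shrinking transitions to chart embeddings and changes of charts *)

Section Restrictions.
Context (R : realType).

(** Adding [C] to the atlas of [V] keeps it equivalent to the atlas [A0] that defines the structure,
    since [C] embeds in a chart of their union. *)
Lemma chart_of_embedding v n (Q : orbifold R v n) (V : representative Q)
    (i : rp_index V) (C : orb_chart R Q n) (mu : C -> V i) :
  chart_embedding mu -> chart_of C.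
Proof.
move=> emu; have [A0 _ os] := os_class (ob_structure Q).
have [aV aAV] := (os _).1 (rp_atlas V).
exists (fun E => (exists i, V i = E) \/ E = C); last by right.
apply/os; split; first by apply: is_atlas_add emu => //; exists i.
have := @is_atlas_add _ _ _ v _ C (V i) mu aAV _ emu.
have -> : (fun E => (A0 E \/ (exists i, V i = E)) \/ E = C) =
    (fun E => A0 E \/ ((exists i, V i = E) \/ E = C)).
  by apply/funext => E; apply/propext; split; tauto.
by apply; right; exists i.
Qed.

Lemma transition_of_diffeo n (M : smooth_space R n) (A : set M) (f : M -> M) :
  is_diffeo_on A f ->
  exists l : transition M, tdom l = A /\ forall x, A x -> l x = f x.
Proof.
move=> df; have dA : is_diffeo_on A (fun x => if pselect (A x) then f x else x).
  by apply: diffeo_eq df _ => x Ax; case: pselect.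
have off x : ~ A x -> (if pselect (A x) then f x else x) = x.
  by case: pselect.
by exists (Transition dA off); split=> // x Ax /=; case: pselect.
Qed.

Lemma preserving_restr n (M : smooth_space R n) (P : Type) (p : M -> P)
    (f g : transition M) : preserving p f -> tdom g `<=` tdom f ->
  (forall x, tdom g x -> g x = f x) -> preserving p g.
Proof. by move=> pf gf E x gx; rewrite E // pf //; exact: gf. Qed.

Lemma near_restr n (M : smooth_space R n) (f g : transition M) x :
  (forall x, tdom g x -> g x = f x) -> tdom g x -> \forall y \near x, g y = f y.
Proof.
by move=> gf gx; near=> y; apply: gf; near: y; exact: tdom_near.
Unshelve. all: by end_near. Qed.

Section Total.
Context (v : version) (n : nat) (Q : orbifold R v n) (V : representative Q).

Lemma in_total_proj (x : total V) : in_total (projT2 x) = x.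
Proof. by case: x. Qed.

Lemma in_total_diffeo i : is_diffeo_on setT (@in_total R v n Q V i).
Proof. by have [x0 _] := oc_nonempty (V i); exact: coprod_in_diffeo x0. Qed.

Lemma in_total_inj i : injective (@in_total R v n Q V i).
Proof. by move=> x y; exact: coprod_in_inj. Qed.

Lemma open_summand i : open [set x : total V | projT1 x = i].
Proof.
rewrite (_ : mkset _ = range (@in_total R v n Q V i)).
  by apply: open_coprod_in; exact: openT.
by apply/seteqP; split=> x /coprod_in_range.
Qed.

Lemma total_factor (T : Type) (A : set T) (f : T -> total V) (k : rp_index V) :
  (forall x, A x -> projT1 (f x) = k) ->
  exists h : T -> V k, forall x, A x -> in_total (h x) = f x.
Proof.
move=> fk; have [x0 _] := oc_nonempty (V k).
by exists (fun x => coprod_out x0 (f x)) => x /fk; exact: coprod_outK.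
Qed.

Lemma total_factor_diffeo (M : smooth_space R n) (A : set M) (f : M -> total V)
    (k : rp_index V) (h : M -> V k) :
  is_diffeo_on A f -> (forall x, A x -> in_total (h x) = f x) ->
  is_diffeo_on A h.
Proof.
move=> df hf; have [x0 _] := oc_nonempty (V k).
have dout : is_diffeo_on (range (@in_total R v n Q V k)) (coprod_out x0).
  by apply: diffeo_inv (in_total_diffeo k) _ => x _; exact: coprod_inK.
have : is_diffeo_on A (coprod_out x0 \o f).
  by apply: diffeo_comp df dout _ => _ [x Ax <-]; exists (h x) => //; exact: hf.
move=> dcf; apply: diffeo_eq dcf _ => x Ax; rewrite /= -hf //; exact: coprod_inK.
Qed.

Lemma total_factor_smooth m (M : smooth_space R m) (f : M -> total V)
    (k : rp_index V) (h : M -> V k) :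
  smooth f -> (forall x, in_total (h x) = f x) -> smooth h.
Proof.
move=> sf hf x; have [x0 _] := oc_nonempty (V k).
have dout : is_diffeo_on (range (@in_total R v n Q V k)) (coprod_out x0).
  by apply: diffeo_inv (in_total_diffeo k) _ => y _; exact: coprod_inK.
rewrite (_ : h = coprod_out x0 \o f).
  apply: smooth_at_comp (sf x) _; apply: diffeo_smooth dout _.
  by rewrite -hf; exists (h x).
by apply/funext => y; rewrite /= -hf; apply/esym; exact: coprod_inK.
Qed.

(** The domain of [nu] is a stable neighborhood of [y], that is, a restricted chart [C] included by
    [mu]; the second embedding [kappa] is [g] after this inclusion. *)
Lemma embedding_restriction (g : transition (total V)) y : Psi V g -> tdom g y ->
  exists nu : transition (total V), [/\ Psi V nu, atlas_embedding nu, tdom nu y,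
    tdom nu `<=` tdom g & forall z, tdom nu z -> nu z = g z].
Proof.
move=> pg gy; case: y gy => j y gy; set k := projT1 (g (in_total y)).
(* On [N] the transition takes values in the single chart [V k]. *)
pose N := (@in_total R v n Q V j) @^-1`
  (tdom g `&` g @^-1` [set x | projT1 x = k]).
have oN : open N.
  apply: open_comp.
    by move=> x _; exact: diffeo_continuous (in_total_diffeo j) _.
  by apply: open_preimage_transition; exact: open_summand.
have [|C [mu [rmu muy muN]]] := restriction_exists oN (_ : N y); first by split.
have [[dmu pmu] _ _] := rmu.
have dim : is_diffeo_on setT (@in_total R v n Q V j \o mu).
  exact: diffeo_comp dmu (in_total_diffeo j) _.
have Sg : range (@in_total R v n Q V j \o mu) `<=` tdom g.
  by move=> _ [z _ <-]; have [] := muN (mu z) (ex_intro2 _ _ z I erefl).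
have oS : open (range (@in_total R v n Q V j \o mu)) by case: dim.
have [nu [dnu nug]] := transition_of_diffeo (diffeo_sub (tdiffeo g) oS Sg).
have [kappa kE] : exists kappa : C -> V k, forall z, setT z ->
    in_total (kappa z) = g (in_total (mu z)).
  apply: (@total_factor C setT (fun z => g (in_total (mu z)))) => z _.
  by have [] := muN (mu z) (ex_intro2 _ _ z I erefl).
have dk : is_diffeo_on setT kappa.
  apply: (total_factor_diffeo _ kE).
  exact: diffeo_comp dim (tdiffeo g) Sg.
exists nu; split.
- by apply: preserving_restr pg _ _; rewrite dnu.
- exists j, k, C, mu, kappa; split=> //.
  + by apply: chart_of_embedding; split; [exact: dmu|].
  + split=> // z; rewrite -pmu.
    have := pg (in_total (mu z)) (Sg _ (ex_intro2 _ _ z I erefl)).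
    by rewrite -kE.
  + by move=> z; rewrite kE // nug //; exists z.
- by rewrite dnu; have [z _ <-] := muy; exists z.
- by rewrite dnu.
- by rewrite dnu.
Qed.

(** A connected neighborhood that [f] maps into one chart gives a change of charts. Through [W] an
    open condition on the base points can be imposed. *)
Lemma change_restriction (f : transition (total V)) x (W : set (total V)) :
  Psi V f -> tdom f x -> open W -> W x ->
  exists l : transition (total V), [/\ Psi V l, atlas_change l, tdom l x,
    tdom l `<=` tdom f `&` W & forall z, tdom l z -> l z = f z].
Proof.
move=> pf fx oW Wx; case: x fx Wx => i x fx Wx.
set j := projT1 (f (in_total x)).
pose N := (@in_total R v n Q V i) @^-1`
  ((tdom f `&` f @^-1` [set x | projT1 x = j]) `&` W).
have oN : open N.
  apply: open_comp.
    by move=> z _; exact: diffeo_continuous (in_total_diffeo i) _.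
  by apply: openI => //; apply: open_preimage_transition; exact: open_summand.
have [A [oA cA Ax AN]] := smooth_locally_connected oN (conj (conj fx erefl) Wx).
have dA : is_diffeo_on A (@in_total R v n Q V i).
  exact: diffeo_sub (in_total_diffeo i) oA _.
have Sf : @in_total R v n Q V i @` A `<=` tdom f.
  by move=> _ [z /AN [[fz _] _] <-].
have oS : open (@in_total R v n Q V i @` A) by case: dA.
have [l [dl lf]] := transition_of_diffeo (diffeo_sub (tdiffeo f) oS Sf).
have [h hE] : exists h : V i -> V j, forall z, A z ->
    in_total (h z) = f (in_total z).
  by apply: total_factor => z /AN [[]].
have dh : is_diffeo_on A h.
  apply: (total_factor_diffeo _ hE); exact: diffeo_comp dA (tdiffeo f) Sf.
exists l; split.
- by apply: preserving_restr pf _ _; rewrite dl.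
- exists i, j, A, h; split=> //.
  + split=> //; first by exists x.
    * apply: connected_image_on => // z Az; exact: diffeo_continuous dh _.
    * move=> z Az; have := pf (in_total z) (Sf _ (ex_intro2 _ _ z Az erefl)).
      by rewrite -hE.
  + by move=> z Az; rewrite hE // lf //; exists z.
- by rewrite dl; exists x.
- by rewrite dl => z Sz; split; [exact: Sf|have [w /AN [_ Ww] <-] := Sz].
- by rewrite dl.
Qed.

End Total.

End Restrictions.

(** * The homomorphism of a representative *)

Section GermMaps.
Context (R : realType).

Lemma mk_germ_restr n (M : smooth_space R n) (P : Type) (p : M -> P)
    (f g : transition M) x : preserving p f -> tdom g `<=` tdom f ->
  (forall y, tdom g y -> g y = f y) -> tdom g x -> mk_germ p x g = mk_germ p x f.
Proof.
move=> pf gf E gx; apply/mk_germ_eqP => //.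
- exact: preserving_restr pf gf E.
- exact: gf.
- exact: near_restr E gx.
Qed.

Lemma mk_germ_eqE n (M : smooth_space R n) (P : Type) (p : M -> P)
    (f g : transition M) x : preserving p f -> tdom f x -> preserving p g ->
  tdom g x -> mk_germ p x f = mk_germ p x g <-> germ x f = germ x g.
Proof. by move=> pf fx pg gx; rewrite mk_germ_eqP // germ_eqP. Qed.

(** If [g] has the same germ as [f] at [x], the two agree on a neighborhood and so have the same
    germs at all nearby points. *)
Lemma open_germs n (M : smooth_space R n) (P : Type) (p : M -> P)
    (f : transition M) : preserving p f ->
  open [set b : germ_space p | exists2 z, tdom f z & b = mk_germ p z f].
Proof.
move=> pf; rewrite germ_openE => g pg.
rewrite openE => x [gx [z fz E]].
have xz : x = z by have := congr1 (@asrc _ _ _ _ _) E; rewrite !asrc_mk.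
subst z; have {}E : \forall y \near x, g y = f y by apply/(mk_germ_eqP pg gx pf fz).
have E' := near_join E; have N1 := tdom_near gx; have N2 := tdom_near fz.
near=> y; split; first by near: y.
have fy : tdom f y by near: y.
exists y => //; apply/mk_germ_eqP => //; by near: y.
Unshelve. all: by end_near. Qed.

(** The base point is a local coordinate on either germ space, and near the germ of [f] the map
    [phi1] reads there as [phi0]. *)
Lemma germ_map_smooth_at n m (M : smooth_space R n) (N : smooth_space R m)
    (P P' : Type) (p : M -> P) (p' : N -> P') (phi0 : M -> N)
    (phi1 : germ_space p -> germ_space p') f f' x :
  smooth phi0 -> preserving p f -> preserving p' f' -> tdom f x ->
  tdom f' (phi0 x) ->
  (forall y, tdom f y -> tdom f' (phi0 y) ->
     phi1 (mk_germ p y f) = mk_germ p' (phi0 y) f') ->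
  smooth_at phi1 (mk_germ p x f).
Proof.
move=> s0 pf pf' fx fx' E c d [f1 [pf1 [c0 [Hc ->]]]] [f1' [pf1' [d0 [Hd ->]]]].
move=> a b /= [ca f1a] [db f1b]; rewrite /germ_param_map E // => cax dbx.
have {ca} [ca xE] : lp_dom c0 a /\ c0 a = x.
  by split=> //; have := congr1 (@asrc _ _ _ _ _) cax; rewrite !asrc_mk.
have xE' : d0 b = phi0 x.
  by have := congr1 (@asrc _ _ _ _ _) dbx; rewrite !asrc_mk.
rewrite /preimage /= xE in f1a; rewrite /preimage /= xE' in f1b.
(* The given parametrizations use transitions [f1] and [f1'] of their own; these have the same germs
   as [f] and [f'] at the points at hand, hence also nearby. *)
have {cax} Ef : \forall y \near x, f1 y = f y.
  by apply/(mk_germ_eqP pf1 f1a pf fx); rewrite -cax xE.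
have {dbx} Ef' : \forall y \near phi0 x, f1' y = f' y.
  by apply/(mk_germ_eqP pf1' f1b pf' fx'); rewrite -dbx xE'.
have [g [sg gab Eg]] := s0 x c0 d0 Hc Hd a b ca db xE xE'.
exists g; split=> //.
have cc : c0 @ a --> x by rewrite -xE; exact: lp_continuous.
have pc : phi0 @ x --> phi0 x by exact: smooth_at_continuous (s0 x).
have H1 := cc _ (near_join Ef); have H2 := cc _ (tdom_near f1a).
have H3 := cc _ (tdom_near fx).
have H4 := cc _ (pc _ (near_join Ef')); have H5 := cc _ (pc _ (tdom_near f1b)).
have H6 := cc _ (pc _ (tdom_near fx')).
near=> a'.
have -> : mk_germ p (c0 a') f1 = mk_germ p (c0 a') f.
  apply/mk_germ_eqP => //; by [near: a'; exact: H1|near: a'; exact: H2|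
    near: a'; exact: H3].
rewrite E; [|by near: a'; exact: H3|by near: a'; exact: H6].
have <- : phi0 (c0 a') = d0 (g a') by near: a'.
apply/mk_germ_eqP => //; first by near: a'; exact: H6.
  by near: a'; exact: H5.
have : \forall y \near phi0 (c0 a'), f1' y = f' y by near: a'; exact: H4.
by apply: filterS => y ->.
Unshelve. all: by end_near. Qed.

Lemma groupoid_hom_eq n m n' m' (G : smooth_groupoid R n m)
    (H : smooth_groupoid R n' m') (f g : groupoid_hom G H) :
  hobj f = hobj g -> harr f = harr g -> f = g.
Proof.
case: f => f0 f1 a1 a2 a3 a4 a5 a6; case: g => g0 g1 b1 b2 b3 b4 b5 b6 /=.
move=> E0 E1; subst g0 g1; congr GroupoidHom; exact: Prop_irrelevance.
Qed.

End GermMaps.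

Section Maps.
Context (R : realType) (v : version) (n n' : nat).
Context (Q : orbifold R v n) (Q' : orbifold R v n').
Context (V : representative Q) (V' : representative Q').
Local Notation p := (proj_total V).
Local Notation p' := (proj_total V').

Lemma smooth_total m (N : smooth_space R m) (f : total V -> N) :
  (forall i, smooth (fun x : V i => f (in_total x))) -> smooth f.
Proof.
move=> sf [i x]; have [x0 _] := oc_nonempty (V i).
have dout : is_diffeo_on (range (@in_total R v n Q V i)) (coprod_out x0).
  by apply: diffeo_inv (in_total_diffeo i) _ => y _; exact: coprod_inK.
have rx : range (@in_total R v n Q V i) (in_total x) by exists x.
apply: (@smooth_at_near _ _ _ _ _
    ((fun x : V i => f (in_total x)) \o coprod_out x0)).
  have : nbhs (in_total x) (range (@in_total R v n Q V i)).
    by apply: near_open rx; exact: diffeo_open dout.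
  by apply: filterS => _ [y _ <-] /=; congr f; congr in_total; exact: coprod_inK.
by apply: smooth_at_comp; [exact: diffeo_smooth dout rx|exact: sf].
Qed.

Section HomOfRep.
Variable r : orb_map_rep V V'.
Local Notation psi := (om_psi r).

Lemma om_psi_smooth : smooth psi.
Proof.
apply: smooth_total => i x.
have -> : (fun x : V i => psi (in_total x)) =
    @in_total _ _ _ _ V' _ \o projT2 (om_lift r i) by [].
apply: smooth_at_comp; last exact: diffeo_smooth (in_total_diffeo _) I.
by have [sl _] := om_local_lift r i; exact: sl.
Qed.

Lemma om_P_Psi l : om_P r l -> Psi V l.
Proof. by have [sP _] := om_generates r; exact: sP. Qed.

Lemma germ_rep (a : germ_arrow p) : exists l : {l | om_P r l},
  tdom (sval l) (asrc a) /\ a = mk_germ p (asrc a) (sval l).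
Proof.
have [x [f [pf fx ->]]] := germ_arrowP a; rewrite asrc_mk.
have [_ /(_ f x pf fx) [l [Pl lx fl]]] := om_generates r.
exists (exist _ l Pl); split=> //=.
by apply/mk_germ_eqP => //; exact: om_P_Psi.
Qed.

(** An element of [P] with the given germ is chosen; [rep_arrE] shows that the choice does not
    matter. *)
Definition rep_arr (a : germ_arrow p) : germ_arrow p' :=
  mk_germ p' (psi (asrc a)) (om_nu (sval (cid (germ_rep a)))).

Lemma nu_dom (l : {l | om_P r l}) x :
  tdom (sval l) x -> tdom (om_nu l) (psi x).
Proof. by move=> lx; have [] := om_nu_psi lx. Qed.

Lemma rep_arrE (l : {l | om_P r l}) x : tdom (sval l) x ->
  rep_arr (mk_germ p x (sval l)) = mk_germ p' (psi x) (om_nu l).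
Proof.
move=> lx; rewrite /rep_arr; case: cid => m /=; rewrite asrc_mk => -[mx E].
apply/mk_germ_eqE; [exact: om_nu_Psi|exact: nu_dom|exact: om_nu_Psi|exact: nu_dom|].
apply: om_nu_germ => //.
exact/esym/(mk_germ_eqE (om_P_Psi (svalP l)) lx (om_P_Psi (svalP m)) mx).
Qed.

Lemma rep_arr_smooth : smooth (rep_arr : germ_space p -> germ_space p').
Proof.
move=> a; have [l [lx ->]] := germ_rep a.
apply: (germ_map_smooth_at om_psi_smooth _ _ lx (nu_dom lx)).
- exact/om_P_Psi/svalP.
- exact: om_nu_Psi.
- by move=> y ly _; exact: rep_arrE.
Qed.

Lemma rep_arr_tgt a : atgt (rep_arr a) = psi (atgt a).
Proof.
have [l [lx E]] := germ_rep a; rewrite E rep_arrE // !atgt_mk //.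
- by rewrite /om_psi; have [_ ->] := om_nu_psi lx.
- exact/om_P_Psi/svalP.
- exact: om_nu_Psi.
- exact: nu_dom.
Qed.

Lemma rep_arr_unit x : rep_arr (unit_germ p x) = unit_germ p' (psi x).
Proof.
have [l] := germ_rep (unit_germ p x); rewrite /= => -[lx E].
rewrite E rep_arrE // unit_germE.
apply/mk_germ_eqE => //; [exact: om_nu_Psi|exact: nu_dom|].
apply: om_nu_id => //.
have pl := om_P_Psi (svalP l); rewrite unit_germE in E.
exact: (mk_germ_eqP pl lx (@preserving_id _ _ _ _ p) I).1 (esym E).
Qed.

Lemma rep_arr_mul b a : asrc b = atgt a ->
  rep_arr (amul b a) = amul (rep_arr b) (rep_arr a).
Proof.
have [l [lx Ea]] := germ_rep a; have [m [mx Eb]] := germ_rep b.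
have pl := om_P_Psi (svalP l); have pm := om_P_Psi (svalP m).
move=> e; have eb : asrc b = sval l (asrc a) by rewrite e Ea atgt_mk // asrc_mk.
move: lx mx Ea Eb; rewrite eb; move: (asrc a) => x lx mx -> ->.
rewrite amul_mk //.
(* The composite itself need not belong to [P], so it is replaced by an element [h] of [P] with the
   same germ, to which [om_nu_comp] applies. *)
have [h [hx Eh]] := germ_rep (mk_germ p x (tcomp (sval m) (sval l))).
rewrite asrc_mk in hx Eh.
have [nlx pse] := om_nu_psi lx.
have nmx := nu_dom mx; rewrite Eh !rep_arrE // /om_psi.
rewrite /om_psi pse in nmx *; rewrite amul_mk //; try exact: om_nu_Psi.
have tD : tdom (tcomp (sval m) (sval l)) x by [].
apply/mk_germ_eqE.
- exact: om_nu_Psi.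
- exact: nu_dom.
- by apply: preserving_comp; exact: om_nu_Psi.
- by split.
apply/esym/om_nu_comp => //.
have Ehm : \forall y \near x, tcomp (sval m) (sval l) y = sval h y.
  have ph := om_P_Psi (svalP h).
  exact: (mk_germ_eqP (preserving_comp pl pm) tD ph hx).1 Eh.
have := tdom_near tD; apply: filterS2 Ehm => y <- Dy.
by rewrite /= tcomp_funE.
Qed.

Definition hom_of_rep : Hom_atlas V V' :=
  @GroupoidHom R n n n' n' (atlas_groupoid V) (atlas_groupoid V') psi rep_arr
    om_psi_smooth rep_arr_smooth (fun a => asrc_mk _ _ _) rep_arr_tgt
    rep_arr_unit (fun b a e _ => rep_arr_mul e).

Lemma hom_of_rep_germs : hom_on_germs r hom_of_rep.
Proof. by move=> l x lx; exact: rep_arrE. Qed.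

Lemma hom_of_rep_unique (phi : Hom_atlas V V') :
  hobj phi = psi -> hom_on_germs r phi -> hom_of_rep = phi.
Proof.
move=> E0 E1; apply: groupoid_hom_eq => //; apply/funext => a.
have [l [lx ->]] := germ_rep a.
by rewrite E1 // E0; exact: rep_arrE.
Qed.

End HomOfRep.
End Maps.

(** * The representative of a homomorphism *)

Section OrbitMaps.
Context (R : realType) (v : version) (n : nat) (Q : orbifold R v n).
Context (V : representative Q).

Lemma proj_total_continuous : continuous (proj_total V).
Proof.
by move=> [i x] A HA; exact: (@oc_map_continuous _ _ _ (V i) x A HA).
Qed.

Lemma proj_total_surj q : exists x, proj_total V x = q.
Proof.
have [A qA] := alpha_surj V q.
by exists (orbit_repr A); rewrite -qA.
Qed.

Lemma representative_compatible (i j : rp_index V) : compatible (V i) (V j).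
Proof.
have [A _ E] := os_class (ob_structure Q).
have [[cV _ _] _] := (E _).1 (rp_atlas V).
by apply: cV; [exists i|exists j].
Qed.

(** A change of charts from [x] to [y], carried to the total space by the two summand inclusions, is
    the required transition. Thus each fiber lies in a single orbit. *)
Lemma same_orbit (x y : total V) : proj_total V x = proj_total V y ->
  exists f, [/\ Psi V f, tdom f x & f x = y].
Proof.
case: x => i x; case: y => j y xy.
have [A [h [Ax hx [A0 cA chA dh ph]]]] :=
  change_of_charts_at (@representative_compatible i j) xy.
have dout : is_diffeo_on (range (@in_total R v n Q V i)) (coprod_out x).
  by apply: diffeo_inv (in_total_diffeo i) _ => z _; exact: coprod_inK.
have oA : open A by case: dh.
have dA : is_diffeo_on (@in_total R v n Q V i @` A) (coprod_out x).
  apply: diffeo_sub dout _ _; last by move=> _ [z _ <-]; exists z.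
  exact: diffeo_image_open (in_total_diffeo i) oA _.
have oK (z : V i) : coprod_out x (in_total z) = z by exact: coprod_inK.
have dj : is_diffeo_on (@in_total R v n Q V i @` A)
    (@in_total R v n Q V j \o (h \o coprod_out x)).
  apply: diffeo_comp (in_total_diffeo j) _ => //.
  by apply: diffeo_comp dA dh _ => _ [_ [z Az <-] <-]; rewrite oK.
have [f [df fE]] := transition_of_diffeo dj.
have fin z : A z -> f (in_total z) = in_total (h z).
  by move=> Az; rewrite fE /= ?oK //; exists z.
exists f; split.
- by move=> z; rewrite df => -[w Aw <-]; rewrite fin //; exact: ph.
- by rewrite df; exists x.
- by rewrite [LHS]fin // hx.
Qed.

End OrbitMaps.

Section RepOfHom.
Context (R : realType) (v : version) (n n' : nat).
Context (Q : orbifold R v n) (Q' : orbifold R v n').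
Context (V : representative Q) (V' : representative Q').
Local Notation p := (proj_total V).
Local Notation p' := (proj_total V').
Variable phi : Hom_atlas V V'.
Let phi0 : total V -> total V' := hobj phi.
Let phi1 : germ_space p -> germ_space p' := harr phi.

Let s0 : smooth phi0 := @hobj_smooth _ _ _ _ _ _ _ phi.
Let s1 : smooth phi1 := @harr_smooth _ _ _ _ _ _ _ phi.

Definition hom_map : Q -> Q' := alpha V' \o hom_orbit phi \o alpha_inv V.

Let src1 a : asrc (phi1 a) = phi0 (asrc a).
Proof. exact: (hom_src phi a). Qed.

Let tgt1 a : atgt (phi1 a) = phi0 (atgt a).
Proof. exact: (hom_tgt phi a). Qed.

Lemma germ_of_hom f x : Psi V f -> tdom f x ->
  exists g, [/\ Psi V' g, tdom g (phi0 x) &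
    phi1 (mk_germ p x f) = mk_germ p' (phi0 x) g].
Proof.
move=> pf fx; have [y [g [pg gy E]]] := germ_arrowP (phi1 (mk_germ p x f)).
have := src1 (mk_germ p x f); rewrite E !asrc_mk => <-.
by exists g.
Qed.

(** [alpha_inv] picks the orbit of some [y] over [p x]. An arrow from [y] to [x] goes to one from
    [phi0 y] to [phi0 x], so these have the same image in [Q']. *)
Lemma hom_mapE x : hom_map (p x) = p' (phi0 x).
Proof.
rewrite /hom_map /=.
have [y yx E] : exists2 y, p y = p x &
    alpha_inv V (p x) = @to_orbit _ _ _ (atlas_groupoid V) y.
  exists (orbit_repr (alpha_inv V (p x))); last by rewrite orbit_reprK.
  by rewrite -[RHS](svalP (cid (alpha_surj V (p x)))).
rewrite E hom_orbitE alphaE.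
have [f [pf fy fyx]] := same_orbit yx.
have [g [pg gy Eg]] := germ_of_hom pf fy.
have := tgt1 (mk_germ p y f); rewrite Eg !atgt_mk // fyx => <-.
by rewrite pg.
Qed.

Lemma phi0_continuous : continuous phi0.
Proof. by move=> x; exact: (smooth_at_continuous (@s0 x)). Qed.

Lemma hom_map_continuous : continuous hom_map.
Proof.
apply/continuousP => A oA.
(* The preimage is computed upstairs, where the map is [p' \o phi0], and pushed down along the open
   chart projections. *)
rewrite (_ : _ @^-1` _ = \bigcup_i (orbmap (V i) @`
    ((fun x : V i => p' (phi0 (in_total x))) @^-1` A))).
  apply: bigcup_open => i _; apply: oc_map_open; apply: open_comp => // x _.
  apply: (@continuous_comp _ _ _ (fun x : V i => phi0 (in_total x)) p');
    last exact: proj_total_continuous.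
  apply: (@continuous_comp _ _ _ (@in_total _ _ _ _ V i) phi0);
    last exact: phi0_continuous.
  exact: diffeo_continuous (in_total_diffeo i) I.
apply/seteqP; split=> [q|_ [i _ [x Ax <-]]].
  have [[i x] <-] := proj_total_surj V q.
  by rewrite /preimage /= hom_mapE => Ax; exists i => //; exists x.
by rewrite /preimage /= (hom_mapE (in_total x)).
Qed.

(** The chart [V i] is connected and the summands of the target are open and disjoint, so [phi0]
    maps it into a single summand. *)
Lemma hom_lift_ex (i : rp_index V) :
  exists F : {j : rp_index V' & V i -> V' j},
    forall x, in_total (projT2 F x) = phi0 (in_total x).
Proof.
have [x0 _] := oc_nonempty (V i); pose f (x : V i) := phi0 (in_total x).
have cf : continuous f.
  move=> x; apply: (@continuous_comp _ _ _ (@in_total _ _ _ _ V i) phi0);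
    last exact: phi0_continuous.
  exact: diffeo_continuous (in_total_diffeo i) I.
pose k := projT1 (f x0); pose S j := f @^-1` [set y | projT1 y = j].
have oS j : open (S j) by apply: open_comp; [|exact: open_summand].
have Sk : S k = setT.
  apply: (@oc_connected _ _ _ (V i)); first by exists x0.
    by exists (S k); rewrite // setTI.
  exists (S k); last by rewrite setTI.
  rewrite -[S k]setCK; apply: open_closedC.
  rewrite (_ : ~` S k = \bigcup_(j in [set~ k]) S j); first exact: bigcup_open.
  apply/seteqP; split=> [x Skx|x [j jk Sjx] Skx]; first by exists (projT1 (f x)).
  by apply: jk; rewrite -[j]Sjx.
have fk x : setT x -> projT1 (f x) = k.
  by have : S k x by rewrite Sk.
have [h hE] := total_factor fk.
by exists (existT _ k h) => x; exact: hE.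
Qed.

Definition hom_lift : lift_family V V' := fun i => sval (cid (hom_lift_ex i)).

Lemma hom_liftE i x : in_total (projT2 (hom_lift i) x) = phi0 (in_total x).
Proof. exact: (svalP (cid (hom_lift_ex i))). Qed.

Lemma coprod_hom_lift x : coprod_lift hom_lift x = phi0 x.
Proof. by rewrite /coprod_lift hom_liftE in_total_proj. Qed.

Lemma hom_local_lift i : local_lift hom_map (projT2 (hom_lift i)).
Proof.
split=> [|x].
  apply: (@total_factor_smooth _ _ _ _ V' _ _ (fun x : V i => phi0 (in_total x))).
    move=> x; apply: (@smooth_at_comp _ _ _ _ _ _ _ (@in_total _ _ _ _ V i) phi0).
      exact: diffeo_smooth (in_total_diffeo i) I.
    exact: s0.
  by move=> x; exact: hom_liftE.
by have := hom_mapE (in_total x); rewrite -hom_liftE => ->.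
Qed.

(** The condition on [tdom nu] is stated separately because [mk_germ] returns a default unit germ
    off the domain. *)
Definition realizes (l : transition (total V)) (nu : transition (total V')) :=
  [/\ Psi V' nu, atlas_embedding nu & forall x, tdom l x ->
    tdom nu (phi0 x) /\ phi1 (mk_germ p x l) = mk_germ p' (phi0 x) nu].

Definition hom_P : set (transition (total V)) :=
  [set l | [/\ Psi V l, atlas_change l & exists nu, realizes l nu]].

Lemma hom_P_restriction f x W : Psi V f -> tdom f x -> open W -> W x ->
  exists l, [/\ hom_P l, tdom l x, tdom l `<=` tdom f `&` W &
    forall z, tdom l z -> l z = f z].
Proof.
move=> pf fx oW Wx; have [g [pg gx Eg]] := germ_of_hom pf fx.
have [nu [pnu enu nux nug Enu]] := embedding_restriction pg gx.
(* The points at which [phi1] sends the germ of [f] into the open set [O'] form an open neighborhood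
   of [x]; [f] is cut down to it. *)
pose O' := [set b : germ_space p' | exists2 z, tdom nu z & b = mk_germ p' z nu].
have oO : open (phi1 @^-1` O').
  apply: open_comp; last exact: open_germs.
  by move=> a _; exact: (smooth_at_continuous (@s1 a)).
rewrite germ_openE in oO; have {}oO := oO f pf.
have Ox : [set y | tdom f y /\ (phi1 @^-1` O') (mk_germ p y f)] x.
  split=> //; exists (phi0 x) => //.
  by rewrite Eg; apply/esym; exact: mk_germ_restr.
have [l [pl cl lx lW lf]] :=
  change_restriction pf fx (openI oW oO) (conj Wx Ox).
exists l; split=> //; last by move=> y /lW [fy [Wy _]].
split=> //; exists nu; split=> // y ly; have [fy [_ [_ [z nuz Ez]]]] := lW y ly.
have lf' : tdom l `<=` tdom f by move=> ? /lW [].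
rewrite (mk_germ_restr pf lf' lf ly) Ez.
(* Comparing sources shows that the base point [z] of the germ of [nu] is [phi0 y]. *)
by have := src1 (mk_germ p y f); rewrite Ez !asrc_mk => <-.
Qed.

Lemma hom_P_Psi l : hom_P l -> Psi V l. Proof. by case. Qed.

Lemma hom_changes l : hom_P l -> atlas_change l. Proof. by case. Qed.

(** Inverses and composites stay in [Psi V], and near each point of their domain they restrict to
    elements of [hom_P]. *)
Lemma hom_quasi : quasi_pseudogroup hom_P.
Proof.
split=> [f x Pf fx|f g x Pf Pg fx [_ gfx]].
  have pf := hom_P_Psi Pf.
  have [g [Pg gfx gf gE]] := hom_P_restriction (preserving_inv pf)
    (ex_intro2 _ _ x fx erefl : tdom (tinv f) (f x)) openT I.
  have gf' : tdom g `<=` tcod f by move=> ? /gf [].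
  have oU : open (tdom f `&` f @^-1` tdom g).
    by apply: open_preimage_transition; exact: tdom_open.
  (* Since [g] restricts the inverse of [f], the preimage of its whole domain is mapped onto that
     domain. *)
  exists g, (tdom f `&` f @^-1` tdom g), (tdom g); split=> //.
  - by split=> //; exact: tdom_open.
  - by split.
  - split; last by move=> y [fy gy]; rewrite gE //= tinvK.
    apply/seteqP; split=> [_ [y [_ gy] <-]|z gz]; first exact: gy.
    by have [y fy yz] := gf' z gz; exists y => //; split=> //; rewrite /preimage /= yz.
have pc := preserving_comp (hom_P_Psi Pf) (hom_P_Psi Pg).
have [h [Ph hx hD hE]] := hom_P_restriction pc (conj fx gfx : tdom (tcomp g f) x) openT I.
exists h, (tdom h); split=> //; first exact: tdom_open.
  move=> y hy; have [[fy gy] _] := hD y hy.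
  by split=> //; split=> //; split=> //; exists y.
by move=> y hy; rewrite hE //= tcomp_funE //; have [] := hD y hy.
Qed.

Lemma hom_generates : generates hom_P (Psi V).
Proof.
split=> [l /hom_P_Psi //|f x pf fx].
have [l [Pl lx lf E]] := hom_P_restriction pf fx openT I.
exists l; split=> //.
have := near_restr E lx; apply: filterS => y ->; by [].
Qed.

Definition hom_nu (l : {l | hom_P l}) : transition (total V') :=
  sval (cid (let: And3 _ _ H := svalP l in H)).

Lemma hom_nuP l : realizes (sval l) (hom_nu l).
Proof. by rewrite /hom_nu; case: cid. Qed.

Lemma hom_nu_Psi l : Psi V' (hom_nu l). Proof. by case: (hom_nuP l). Qed.

Lemma hom_nu_embedding l : atlas_embedding (hom_nu l).
Proof. by case: (hom_nuP l). Qed.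

Lemma hom_nu_dom l x : tdom (sval l) x -> tdom (hom_nu l) (phi0 x).
Proof. by case: (hom_nuP l) => _ _ H /H []. Qed.

Lemma hom_nuE l x : tdom (sval l) x ->
  phi1 (mk_germ p x (sval l)) = mk_germ p' (phi0 x) (hom_nu l).
Proof. by case: (hom_nuP l) => _ _ H /H []. Qed.

Let Psil (l : {l | hom_P l}) : preserving p (sval l).
Proof. exact: hom_P_Psi (svalP l). Qed.

Lemma hom_nu_tgt l x : tdom (sval l) x -> hom_nu l (phi0 x) = phi0 (sval l x).
Proof.
move=> lx; have := tgt1 (mk_germ p x (sval l)); rewrite hom_nuE // !atgt_mk //.
  exact: hom_nu_Psi.
exact: hom_nu_dom.
Qed.

Lemma hom_nu_psi l x : tdom (sval l) x ->
  tdom (hom_nu l) (coprod_lift hom_lift x) /\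
  coprod_lift hom_lift (sval l x) = hom_nu l (coprod_lift hom_lift x).
Proof.
by move=> lx; rewrite !coprod_hom_lift hom_nu_tgt //; split=> //; exact: hom_nu_dom.
Qed.

Lemma hom_nu_germ l m x : tdom (sval l) x -> tdom (sval m) x ->
  germ x (sval l) = germ x (sval m) ->
  germ (coprod_lift hom_lift x) (hom_nu l) =
  germ (coprod_lift hom_lift x) (hom_nu m).
Proof.
move=> lx mx E; rewrite coprod_hom_lift.
apply/(mk_germ_eqE (p := p')); [exact: hom_nu_Psi|exact: hom_nu_dom|
  exact: hom_nu_Psi|exact: hom_nu_dom|].
by rewrite -!hom_nuE //; congr phi1; apply/mk_germ_eqE.
Qed.

Lemma hom_nu_comp l m h x :
  tdom (sval l) x -> tdom (sval m) (sval l x) -> tdom (sval h) x ->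
  (\forall y \near x, sval h y = sval m (sval l y)) ->
  germ (coprod_lift hom_lift x) (tcomp (hom_nu m) (hom_nu l)) =
  germ (coprod_lift hom_lift x) (hom_nu h).
Proof.
move=> lx mx hx E; rewrite coprod_hom_lift.
have nl := hom_nu_dom lx; have nm := hom_nu_dom mx.
rewrite -hom_nu_tgt // in nm.
apply/(mk_germ_eqE (p := p')).
- by apply: preserving_comp; exact: hom_nu_Psi.
- by split.
- exact: hom_nu_Psi.
- exact: hom_nu_dom.
rewrite -(amul_mk (@hom_nu_Psi l) nl (@hom_nu_Psi m) nm) hom_nu_tgt // -!hom_nuE //.
have tD : tdom (tcomp (sval m) (sval l)) x by [].
(* The germ of [h] is a product of arrows, so the claim becomes multiplicativity of [phi]. *)
have -> : mk_germ p x (sval h) =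
    amul (mk_germ p (sval l x) (sval m)) (mk_germ p x (sval l)).
  rewrite amul_mk //; apply/mk_germ_eqP => //; first exact: preserving_comp.
  have := tdom_near tD; apply: filterS2 E => y -> Dy.
  by rewrite /= tcomp_funE.
have e : asrc (mk_germ p (sval l x) (sval m)) = atgt (mk_germ p x (sval l)).
  by rewrite asrc_mk atgt_mk.
have e' : asrc (phi1 (mk_germ p (sval l x) (sval m))) =
    atgt (phi1 (mk_germ p x (sval l))).
  by rewrite src1 tgt1 e.
exact/esym/(@hom_mul _ _ _ _ _ _ _ phi _ _ e e').
Qed.

Lemma hom_nu_id l x : tdom (sval l) x -> (\forall y \near x, sval l y = y) ->
  germ (coprod_lift hom_lift x) (hom_nu l) =
  germ (coprod_lift hom_lift x) (tid (total V')).
Proof.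
move=> lx E; rewrite coprod_hom_lift.
apply/(mk_germ_eqE (p := p')) => //; [exact: hom_nu_Psi|exact: hom_nu_dom|].
rewrite -unit_germE -hom_nuE // -[RHS](hom_unit phi x); congr phi1.
by rewrite /= unit_germE; apply/mk_germ_eqP.
Qed.

Definition rep_of_hom : orb_map_rep V V' :=
  OrbMapRep hom_map_continuous hom_local_lift hom_quasi hom_changes
    hom_generates hom_nu_Psi hom_nu_embedding hom_nu_psi hom_nu_germ
    hom_nu_comp hom_nu_id.

Lemma rep_of_hom_psi : om_psi rep_of_hom = phi0.
Proof. by apply/funext => x; exact: coprod_hom_lift. Qed.

Lemma rep_of_hom_germs : hom_on_germs rep_of_hom phi.
Proof. by move=> l x lx; exact: hom_nuE. Qed.

End RepOfHom.

(** * The bijection *)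

Section Bijection.
Context (R : realType) (v : version) (n n' : nat).
Context (Q : orbifold R v n) (Q' : orbifold R v n').
Context (V : representative Q) (V' : representative Q').
Implicit Types (r s : orb_map_rep V V') (phi : Hom_atlas V V').

(** Every point of [Q] lifts to the total space, where the lifts of [r] determine its underlying
    map. *)
Lemma om_map_eq r phi : hobj phi = om_psi r -> om_map r = hom_map phi.
Proof.
move=> E; apply/funext => q; have [x <-] := proj_total_surj V q.
rewrite hom_mapE E; case: x => i x.
by have [_ /(_ x) lE] := om_local_lift r i; exact: (esym lE).
Qed.

(** Charts are nonempty, so the value at one point already fixes the index of the target chart. *)
Lemma om_lift_eq r s : om_psi r = om_psi s -> forall i, om_lift r i = om_lift s i.
Proof.
move=> E i; have {}E x : in_total (projT2 (om_lift r i) x) =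
  in_total (projT2 (om_lift s i) x) := congr1 (fun f => f (in_total x)) E.
case: (om_lift r i) (om_lift s i) E => [j f] [k g] /= E.
have [x0 _] := oc_nonempty (V i).
have jk : j = k := congr1 (@projT1 _ _) (E x0).
subst k; congr existT; apply/funext => x; exact: in_total_inj (E x).
Qed.

Lemma om_psi_eq r phi :
  (forall i (x : V i), in_total (projT2 (om_lift r i) x) = hobj phi (in_total x)) ->
  hobj phi = om_psi r.
Proof. by move=> E; apply/funext => -[i x]; rewrite [RHS]E. Qed.

Lemma om_equivP r s : om_equiv r s <-> hom_of_rep r = hom_of_rep s.
Proof.
split=> [[Em El Eg]|E].
- have Epsi : om_psi s = om_psi r.
    by apply/funext => x; rewrite /om_psi /coprod_lift El.
  apply/esym/hom_of_rep_unique; first exact/esym.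
  move=> m x mx; have [_ gr] := om_generates r.
  have pm := om_P_Psi (svalP m).
  (* The quasi-pseudogroups of [r] and [s] may differ, but the germ of [m] is also that of some [l]
     in the one of [r], and the equivalence compares these two. *)
  have [l [Pl lx ml]] := gr _ _ pm mx.
  pose l' : {l | om_P r l} := exist _ l Pl.
  have lx' : tdom (sval l') x := lx.
  have El' : germ x (sval l') = germ x (sval m).
    by apply/esym/germ_eqP.
  have -> : mk_germ (proj_total V) x (sval m) = mk_germ (proj_total V) x (sval l').
    by apply/esym/mk_germ_eqE => //; exact: (om_P_Psi Pl).
  rewrite [LHS](rep_arrE lx'); apply/mk_germ_eqE.
  + exact: om_nu_Psi.
  + exact: nu_dom.
  + exact: om_nu_Psi.
  + by have := nu_dom mx; rewrite Epsi.
  exact: Eg.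
- have Epsi : om_psi r = om_psi s := congr1 (@hobj _ _ _ _ _ _ _) E.
  split.
  + by rewrite (@om_map_eq r (hom_of_rep r)) // E (@om_map_eq s (hom_of_rep s)).
  + exact: om_lift_eq.
  move=> l m x lx mx lm.
  have pl := om_P_Psi (svalP l); have pm := om_P_Psi (svalP m).
  have mx' : tdom (om_nu m) (om_psi r x) by rewrite Epsi; exact: nu_dom.
  apply/(mk_germ_eqE (p := proj_total V')) => //;
    [exact: om_nu_Psi|exact: nu_dom|exact: om_nu_Psi|].
  rewrite -(rep_arrE lx) Epsi -(rep_arrE mx).
  have -> : mk_germ (proj_total V) x (sval l) = mk_germ (proj_total V) x (sval m).
    exact/mk_germ_eqE.
  exact: (congr1 (fun f : Hom_atlas V V' => harr f _) E).
Qed.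

Lemma om_classP r s : om_class r = om_class s <-> hom_of_rep r = hom_of_rep s.
Proof.
split=> [/(congr1 sval) /= E|E].
  by apply/om_equivP; rewrite E; apply/om_equivP.
apply: eq_exist; apply/funext => t; apply/propext.
by rewrite !om_equivP E.
Qed.

Lemma om_class_surj (c : Orb V V') : exists r, om_class r = c.
Proof.
by case: c => c [r cr]; exists r; apply: eq_exist.
Qed.

Definition orb_to_hom (c : Orb V V') : Hom_atlas V V' :=
  hom_of_rep (sval (cid (om_class_surj c))).

Definition hom_to_orb phi : Orb V V' := om_class (rep_of_hom phi).

Lemma orb_to_hom_class r : orb_to_hom (om_class r) = hom_of_rep r.
Proof. by rewrite /orb_to_hom; case: cid => s /= /om_classP. Qed.

Lemma hom_of_repK phi : hom_of_rep (rep_of_hom phi) = phi.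
Proof.
apply: hom_of_rep_unique; last exact: rep_of_hom_germs.
by rewrite rep_of_hom_psi.
Qed.

Lemma hom_to_orbK : cancel hom_to_orb orb_to_hom.
Proof. by move=> phi; rewrite orb_to_hom_class hom_of_repK. Qed.

Lemma orb_to_homK : cancel orb_to_hom hom_to_orb.
Proof.
move=> c; have [r <-] := om_class_surj c.
by apply/om_classP; rewrite hom_of_repK orb_to_hom_class.
Qed.

End Bijection.

Theorem proposition4p12 (R : realType) (v : version) (n n' : nat)
    (Q : orbifold R v n) (Q' : orbifold R v n')
    (V : representative Q) (V' : representative Q') :
  exists (F1 : Orb V V' -> Hom_atlas V V') (F2 : Hom_atlas V V' -> Orb V V'),
    [/\ (forall r : orb_map_rep V V',
           hobj (F1 (om_class r)) = om_psi r /\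
           hom_on_germs r (F1 (om_class r)) /\
           forall phi : Hom_atlas V V',
             hobj phi = om_psi r -> hom_on_germs r phi ->
             F1 (om_class r) = phi),
        (forall phi : Hom_atlas V V',
           exists r : orb_map_rep V V',
             [/\ om_map r = alpha V' \o hom_orbit phi \o alpha_inv V,
                 forall (i : rp_index V) (x : V i),
                   in_total (projT2 (om_lift r i) x) = hobj phi (in_total x),
                 hom_on_germs r phi &
                 F2 phi = om_class r]),
        (forall (phi : Hom_atlas V V') (r : orb_map_rep V V'),
           om_map r = alpha V' \o hom_orbit phi \o alpha_inv V ->
           (forall (i : rp_index V) (x : V i),
              in_total (projT2 (om_lift r i) x) = hobj phi (in_total x)) ->
           hom_on_germs r phi ->
           F2 phi = om_class r),
        bijective F1 /\ bijective F2 &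
        cancel F1 F2 /\ cancel F2 F1].
Proof.
have K1 := @orb_to_homK _ _ _ _ _ _ V V'.
have K2 := @hom_to_orbK _ _ _ _ _ _ V V'.
exists (@orb_to_hom _ _ _ _ _ _ V V'), (@hom_to_orb _ _ _ _ _ _ V V'); split.
- move=> r; rewrite orb_to_hom_class; split=> //; split.
    exact: hom_of_rep_germs.
  exact: hom_of_rep_unique.
- move=> phi; exists (rep_of_hom phi); split=> //.
    by move=> i x; exact: hom_liftE.
  exact: rep_of_hom_germs.
(* Both [rep_of_hom phi] and [r] induce the homomorphism [phi], hence define the same class. *)
- move=> phi r _ /om_psi_eq E0 E1; apply/om_classP.
  by rewrite hom_of_repK; apply/esym/hom_of_rep_unique.
- by split; [exists (@hom_to_orb _ _ _ _ _ _ V V')|exists (@orb_to_hom _ _ _ _ _ _ V V')].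
- by [].
Qed.
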